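(* For every $r\geqslant 3$, there exist constants $K_r,K'_r,K''_r,M_r>0$ such that, for every $n\geqslant 0$: (i) $K_r n^{r}\leqslant \alpha_r(n)$; (ii) $K'_r n^{r-1}\leqslant \beta_r(n)\leqslant K''_r n^{M_r}$.
   Context: Here $r$ and $n$ are integers. Fix a free basis $a_1,\dots,a_r$ of the free group $F_r$ of rank $r$. For $w\in F_r$, $|w|$ is the length of the reduced word in $a_1^{\pm1},\dots,a_r^{\pm1}$ representing $w$. Automorphisms act on the right. For $\varphi\in \mathrm{Aut}(F_r)$ put $\|\varphi\|=|a_1\varphi|+\cdots+|a_r\varphi|$. For $g\in F_r$ let $\lambda_g$ be the inner automorphism $x\mapsto g^{-1}xg$, let $\Lambda=\{\lambda_g\mid g\in F_r\}$ and $\mathrm{Out}(F_r)=\mathrm{Aut}(F_r)/\Lambda$, whose elements are the cosets $[\varphi]=\varphi\Lambda$. For $\Phi\in\mathrm{Out}(F_r)$ put $\|\Phi\|=\min\{\|\varphi\| \mid \varphi\in\Phi\}$. For $n\in\mathbb{N}=\{0,1,2,\dots\}$ define $$\alpha_r(n)=\max\{\|\varphi^{-1}\| \mid \varphi\in\mathrm{Aut}(F_r),\ \|\varphi\|\leqslant n\},\qquad \beta_r(n)=\max\{\|\Phi^{-1}\| \mid \Phi\in\mathrm{Out}(F_r),\ \|\Phi\|\leqslant n\},$$ with the convention $\max\emptyset=0$.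
   Formalization: The two lower bounds are claimed only for n = 0 and n ≥ r: for 0 < n < r no automorphism has norm at most n, so α_r(n) = β_r(n) = 0 by the convention max ∅ = 0 and the printed lower bounds fail. *)

(* Defs.v *)
From HB Require Import structures.
From mathcomp Require Import all_boot.
From mathcomp Require Import boolp classical_sets.

Set Implicit Arguments.
Unset Strict Implicit.
Unset Printing Implicit Defensive.

(* The free group of rank r, realised as the set of reduced words: the letter
   (i, true) stands for a_i and (i, false) for a_i^-1. *)

Notation letter r := ('I_r * bool)%type.

Section FreeGroup.
Variable r : nat.
Local Notation letter := (letter r).

Definition letterV (a : letter) : letter := (a.1, ~~ a.2).

Definition reduced (w : seq letter) : bool :=
  sorted (fun a b => b != letterV a) w.

(* the reduced form of a :: w, for a reduced word w *)
Definition push (a : letter) (w : seq letter) : seq letter :=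
  if w is b :: w' then (if b == letterV a then w' else a :: w) else [:: a].

Definition word_mul (u v : seq letter) : seq letter := foldr push v u.
Definition word_inv (u : seq letter) : seq letter := rev (map letterV u).

Lemma letterVK : involutive letterV.
Proof. by case=> i b; rewrite /letterV /= negbK. Qed.

Lemma reduced_behead a w : reduced (a :: w) -> reduced w.
Proof. by case: w => //= b w /andP[]. Qed.

Lemma push_cons a w : reduced (a :: w) -> push a w = a :: w.
Proof. by case: w => //= b w /andP[/negPf-> _]. Qed.

Lemma reduced_push a w : reduced w -> reduced (push a w).
Proof.
case: w => [|b w] //= rw; case: ifP => [_|/negbT ba]; last by rewrite /= ba.
exact: reduced_behead rw.
Qed.

Lemma pushK a w : reduced w -> push (letterV a) (push a w) = w.
Proof.
case: w => [|b w] /=; first by rewrite letterVK eqxx.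
move=> rw; case: ifP => [/eqP ba|_]; last by rewrite /= letterVK eqxx.
by rewrite -ba push_cons.
Qed.

Lemma pushVK a w : reduced w -> push a (push (letterV a) w) = w.
Proof. by move=> rw; rewrite -{1}(letterVK a) pushK. Qed.

Lemma reduced_mul u v : reduced v -> reduced (word_mul u v).
Proof. by move=> rv; elim: u => //= a u; apply: reduced_push. Qed.

Lemma word_mul_push a u v : reduced u -> reduced v ->
  word_mul (push a u) v = push a (word_mul u v).
Proof.
case: u => [|b u] //= ru rv; case: ifP => [/eqP->|//].
by rewrite pushVK // reduced_mul.
Qed.

Lemma word_mulA u v w : reduced v -> reduced w ->
  word_mul u (word_mul v w) = word_mul (word_mul u v) w.
Proof.
move=> rv rw; elim: u => //= a u ->.
by rewrite word_mul_push // reduced_mul.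
Qed.

Lemma word_mul1 u : reduced u -> word_mul u [::] = u.
Proof.
by elim: u => //= a u IHu rau; rewrite IHu ?push_cons // (reduced_behead rau).
Qed.

Lemma reduced_inv u : reduced u -> reduced (word_inv u).
Proof.
rewrite /word_inv /reduced rev_sorted sorted_map; apply: sub_sorted => a b /=.
by rewrite letterVK eq_sym.
Qed.

Lemma word_mul_cat u v w : word_mul (u ++ v) w = word_mul u (word_mul v w).
Proof. by rewrite /word_mul foldr_cat. Qed.

Lemma word_mulVr u v : reduced v -> word_mul (word_inv u) (word_mul u v) = v.
Proof.
move=> rv; elim: u => // a u IHu.
rewrite /word_inv map_cons rev_cons -cats1 word_mul_cat /= pushK //.
exact: reduced_mul.
Qed.

Lemma word_invK : involutive word_inv.
Proof.
by move=> u; rewrite /word_inv map_rev revK -map_comp (eq_map letterVK) map_id.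
Qed.

Definition free_group : Type := {w : seq letter | reduced w}.
HB.instance Definition _ := SubChoice.on free_group.

Definition free_one : free_group := exist _ [::] isT.
Definition free_mul (x y : free_group) : free_group :=
  exist _ (word_mul (val x) (val y)) (reduced_mul _ (valP y)).
Definition free_inv (x : free_group) : free_group :=
  exist _ (word_inv (val x)) (reduced_inv (valP x)).

Lemma free_mulA : associative free_mul.
Proof. by move=> x y z; apply: val_inj; apply: word_mulA; apply: valP. Qed.
Lemma free_mul1x : left_id free_one free_mul.
Proof. by move=> x; apply: val_inj. Qed.
Lemma free_mulx1 : right_id free_one free_mul.
Proof. by move=> x; apply: val_inj; apply: word_mul1; apply: valP. Qed.
Lemma free_mulVx : left_inverse free_one free_inv free_mul.
Proof.
by move=> x; apply: val_inj; rewrite /= -{2}(word_mul1 (valP x)) word_mulVr.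
Qed.
Lemma free_mulxV : right_inverse free_one free_inv free_mul.
Proof.
move=> x; have {1}-> : x = free_inv (free_inv x).
  by apply: val_inj; rewrite /= word_invK.
exact: free_mulVx.
Qed.

HB.instance Definition _ := isGroup.Build free_group
  free_mulA free_mul1x free_mulx1 free_mulVx free_mulxV.

Definition gen (i : 'I_r) : free_group := exist _ [:: (i, true)] isT.

Definition wlen (x : free_group) : nat := size (val x).

End FreeGroup.

Local Open Scope group_scope.

Section Automorphisms.
Variable G : groupType.

Record aut : Type := Aut {
  aut_fun :> G -> G;
  autM : {morph aut_fun : x y / x * y};
  aut_bij : bijective aut_fun }.

HB.instance Definition _ := gen_eqMixin aut.
HB.instance Definition _ := gen_choiceMixin aut.

Lemma autP (f g : aut) : f =1 g -> f = g.
Proof.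
case: f g => [f fM fB] [g gM gB] /= /funext fg.
by subst g; congr Aut; apply: Prop_irrelevance.
Qed.

Lemma aut_inv_fun (f : aut) : {g : G -> G | cancel f g & cancel g f}.
Proof.
have : exists2 g : G -> G, cancel f g & cancel g f.
  by case: (aut_bij f) => g fK gK; exists g.
exact: cid2.
Qed.

Definition aut_invf (f : aut) : G -> G := s2val (aut_inv_fun f).
Lemma aut_invfK (f : aut) : cancel f (aut_invf f).
Proof. by rewrite /aut_invf; case: aut_inv_fun. Qed.
Lemma aut_fK (f : aut) : cancel (aut_invf f) f.
Proof. by rewrite /aut_invf; case: aut_inv_fun. Qed.

Lemma aut_invM (f : aut) : {morph aut_invf f : x y / x * y}.
Proof.
by move=> x y; apply: (can_inj (aut_invfK f)); rewrite autM !aut_fK.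
Qed.
Lemma aut_inv_bij (f : aut) : bijective (aut_invf f).
Proof. by exists f; [apply: aut_fK | apply: aut_invfK]. Qed.

Lemma aut_mulM (f g : aut) : {morph g \o f : x y / x * y}.
Proof. by move=> x y /=; rewrite !autM. Qed.
Lemma aut_mul_bij (f g : aut) : bijective (g \o f).
Proof. by apply: bij_comp; apply: aut_bij. Qed.

Definition aut_one : aut := @Aut idfun (fun _ _ => erefl) (inv_bij (fun=> erefl)).
(* Automorphisms act on the right: the product f g is f followed by g. *)
Definition aut_mul (f g : aut) : aut := Aut (aut_mulM f g) (aut_mul_bij f g).
Definition aut_inv (f : aut) : aut := Aut (@aut_invM f) (aut_inv_bij f).

Lemma aut_mulA : associative aut_mul.
Proof. by move=> f g h; apply: autP. Qed.
Lemma aut_mul1f : left_id aut_one aut_mul.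
Proof. by move=> f; apply: autP. Qed.
Lemma aut_mulf1 : right_id aut_one aut_mul.
Proof. by move=> f; apply: autP. Qed.
Lemma aut_mulVf : left_inverse aut_one aut_inv aut_mul.
Proof. by move=> f; apply: autP => x /=; rewrite aut_fK. Qed.
Lemma aut_mulfV : right_inverse aut_one aut_inv aut_mul.
Proof. by move=> f; apply: autP => x /=; rewrite aut_invfK. Qed.

HB.instance Definition _ := isGroup.Build aut
  aut_mulA aut_mul1f aut_mulf1 aut_mulVf aut_mulfV.

Lemma conjg_morph (g : G) : {morph (fun x => g^-1 * x * g) : x y / x * y}.
Proof. by move=> x y; rewrite -!mulgA mulVKg. Qed.
Lemma conjg_bij (g : G) : bijective (fun x : G => g^-1 * x * g).
Proof.
by exists (fun x => g * x * g^-1) => x; rewrite -!mulgA ?mulVKg ?mulKg ?mulgV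
  ?mulVg ?mulKVg ?mulg1.
Qed.

Definition inner (g : G) : aut := Aut (conjg_morph g) (conjg_bij g).

Definition Inn : set aut := range inner.

Local Open Scope classical_set_scope.

Definition inn_coset (f : aut) : set aut := [set f * l | l in Inn].

Lemma innerM (g h : G) : inner (g * h) = inner g * inner h.
Proof. by apply: autP => x /=; rewrite invgM !mulgA. Qed.
Lemma inner1 : inner 1 = 1.
Proof. by apply: autP => x /=; rewrite invg1 mul1g mulg1. Qed.
Lemma innerV (g : G) : inner g^-1 = (inner g)^-1.
Proof. by apply: (@mulgI _ (inner g)); rewrite -innerM !mulgV inner1. Qed.
Lemma innerJ (g : G) (f : aut) : inner g * f = f * inner (f g).
Proof.
apply: autP => x /=; rewrite !autM; congr (_ * _ * _).
by apply: (@mulgI _ (f g)); rewrite -autM !mulgV -(mulg1 1) autM;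
  apply: (@mulgI _ (f 1)); rewrite -!autM !mulg1.
Qed.

Lemma inn_cosetP (f h : aut) : inn_coset f h <-> exists g, h = f * inner g.
Proof.
split=> [[_ [g _ <-] <-]|[g ->]]; first by exists g.
by exists (inner g) => //; exists g.
Qed.

Lemma inn_cosetM (f g : aut) :
  [set a * b | a in inn_coset f & b in inn_coset g] = inn_coset (f * g).
Proof.
apply/seteqP; split=> h.
  case=> _ /inn_cosetP[x ->] [_ /inn_cosetP[y ->] <-].
  apply/inn_cosetP; exists (g x * y).
  by rewrite innerM !mulgA -(mulgA f (inner x)) innerJ !mulgA.
move=> /inn_cosetP[x ->]; exists f.
  by apply/inn_cosetP; exists 1; rewrite inner1 mulg1.
exists (g * inner x); first by apply/inn_cosetP; exists x.
by rewrite mulgA.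
Qed.

Lemma inn_cosetV (f : aut) : [set a^-1 | a in inn_coset f] = inn_coset f^-1.
Proof.
apply/seteqP; split=> h.
  case=> _ /inn_cosetP[x ->] <-; apply/inn_cosetP.
  by exists (f^-1 x^-1); rewrite invgM -innerV innerJ.
move=> /inn_cosetP[x ->]; exists (inner x^-1 * f); last first.
  by rewrite invgM -innerV invgK.
by apply/inn_cosetP; exists (f x^-1); rewrite innerJ.
Qed.

(* The quotient of aut by Inn: its elements are the cosets, multiplied and
   inverted elementwise. *)
Record out : Type := Out {
  out_set : set aut;
  out_setP : exists f, out_set = inn_coset f }.

HB.instance Definition _ := gen_eqMixin out.
HB.instance Definition _ := gen_choiceMixin out.

Lemma out_inj (P Q : out) : out_set P = out_set Q -> P = Q.
Proof.
case: P Q => [P hP] [Q hQ] /= PQ.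
by subst Q; congr Out; apply: Prop_irrelevance.
Qed.

Definition out_class (f : aut) : out :=
  Out (ex_intro (fun g => inn_coset f = inn_coset g) f erefl).

Lemma out_mulP (P Q : out) :
  exists f, [set a * b | a in out_set P & b in out_set Q] = inn_coset f.
Proof.
have [f ->] := out_setP P; have [g ->] := out_setP Q.
by exists (f * g); rewrite inn_cosetM.
Qed.
Lemma out_invP (P : out) :
  exists f, [set a^-1 | a in out_set P] = inn_coset f.
Proof. by have [f ->] := out_setP P; exists f^-1; rewrite inn_cosetV. Qed.

Definition out_one : out := out_class 1.
Definition out_mul (P Q : out) : out := Out (out_mulP P Q).
Definition out_inv (P : out) : out := Out (out_invP P).

Lemma out_classP (P : out) : exists f, P = out_class f.
Proof. by have [f Pf] := out_setP P; exists f; apply: out_inj. Qed.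
Lemma out_class_mul (f g : aut) :
  out_mul (out_class f) (out_class g) = out_class (f * g).
Proof. by apply: out_inj; apply: inn_cosetM. Qed.
Lemma out_class_inv (f : aut) : out_inv (out_class f) = out_class f^-1.
Proof. by apply: out_inj; apply: inn_cosetV. Qed.

Lemma out_mulA : associative out_mul.
Proof.
move=> P Q S; have [f ->] := out_classP P; have [g ->] := out_classP Q.
by have [h ->] := out_classP S; rewrite !out_class_mul mulgA.
Qed.
Lemma out_mul1P : left_id out_one out_mul.
Proof. by move=> P; have [f ->] := out_classP P; rewrite out_class_mul mul1g. Qed.
Lemma out_mulP1 : right_id out_one out_mul.
Proof. by move=> P; have [f ->] := out_classP P; rewrite out_class_mul mulg1. Qed.
Lemma out_mulVP : left_inverse out_one out_inv out_mul.
Proof.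
by move=> P; have [f ->] := out_classP P; rewrite out_class_inv out_class_mul mulVg.
Qed.
Lemma out_mulPV : right_inverse out_one out_inv out_mul.
Proof.
by move=> P; have [f ->] := out_classP P; rewrite out_class_inv out_class_mul mulgV.
Qed.

HB.instance Definition _ := isGroup.Build out
  out_mulA out_mul1P out_mulP1 out_mulVP out_mulPV.

End Automorphisms.

Local Open Scope classical_set_scope.

(* Maximum and minimum of a set of natural numbers; both are 0 on the empty
   set, and set_max is also 0 on unbounded sets (see alpha_max and beta_max
   below: these do not arise). *)
Definition set_max (A : set nat) : nat :=
  xget 0%N [set m | A m /\ forall k, A k -> (k <= m)%N].
Definition set_min (A : set nat) : nat :=
  xget 0%N [set m | A m /\ forall k, A k -> (m <= k)%N].

Definition aut_norm (r : nat) (f : aut (free_group r)) : nat :=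
  (\sum_(i < r) wlen (f (gen i)))%N.

Definition out_norm (r : nat) (P : out (free_group r)) : nat :=
  set_min [set aut_norm f | f in out_set P].

Definition alpha (r n : nat) : nat :=
  set_max [set aut_norm f^-1 | f in [set f : aut (free_group r) | (aut_norm f <= n)%N]].

Definition beta (r n : nat) : nat :=
  set_max [set out_norm P^-1 | P in [set P : out (free_group r) | (out_norm P <= n)%N]].

(* The sets whose maxima define alpha and beta are bounded. *)

Lemma set_maxP (A : set nat) (b : nat) :
    A !=set0 -> (forall k, A k -> (k <= b)%N) ->
  A (set_max A) /\ forall k, A k -> (k <= set_max A)%N.
Proof.
move=> [a Aa] Ab.
suff: exists m, [set m | A m /\ forall k, A k -> (k <= m)%N] m.
  exact: (@xgetPex _ 0%N).
have ex : exists k, `[< A k >] by exists a; apply/asboolP.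
have ub k : `[< A k >] -> (k <= b)%N by move=> /asboolP/Ab.
case: (ex_maxnP ex ub) => m /asboolP Am mmax.
by exists m; split=> // k Ak; apply: mmax; apply/asboolP.
Qed.

Lemma set_minP (A : set nat) : A !=set0 ->
  A (set_min A) /\ forall k, A k -> (set_min A <= k)%N.
Proof.
move=> [a Aa].
suff: exists m, [set m | A m /\ forall k, A k -> (m <= k)%N] m.
  exact: (@xgetPex _ 0%N).
have ex : exists k, `[< A k >] by exists a; apply/asboolP.
case: (ex_minnP ex) => m /asboolP Am mmin.
by exists m; split=> // k Ak; apply: mmin; apply/asboolP.
Qed.

Lemma aut1 (G : groupType) (f : aut G) : f 1 = 1.
Proof. by apply: (@mulgI _ (f 1)); rewrite -autM !mulg1. Qed.

Lemma autV (G : groupType) (f : aut G) x : f x^-1 = (f x)^-1.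
Proof. by apply: (@mulgI _ (f x)); rewrite -autM !mulgV aut1. Qed.

Lemma aut_gen_inj (r : nat) (f g : aut (free_group r)) :
  (forall i, f (gen i) = g (gen i)) -> f = g.
Proof.
move=> fg; apply: autP => -[w rw].
elim: w rw => [|[i b] w IHw] rw.
  have -> : exist _ [::] rw = 1 :> free_group r by apply: val_inj.
  by rewrite !aut1.
have rw' := reduced_behead rw.
have -> : exist _ ((i, b) :: w) rw =
    (if b then gen i else (gen i)^-1) * exist _ w rw' :> free_group r.
  by apply: val_inj; case: b rw => rw /=; rewrite push_cons.
by rewrite !autM IHw; case: (b); rewrite ?autV fg.
Qed.

Lemma aut_norm_bounded (r n : nat) : exists b, forall f : aut (free_group r),
  (aut_norm f <= n)%N -> (aut_norm f^-1 <= b)%N.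
Proof.
pose code := {ffun 'I_r -> n.-bseq (letter r)}.
pose codes (c : code) (f : aut (free_group r)) :=
  forall i, val (f (gen i)) = c i :> seq _.
pose F c := aut_norm (xget 1 (codes c))^-1.
exists (\max_c F c) => f fn.
have sz i : (size (val (f (gen i))) <= n)%N.
  by apply: leq_trans fn; rewrite /aut_norm (bigD1 i) //= leq_addr.
pose c : code := [ffun i => Bseq (sz i)].
have cf : codes c f by move=> i; rewrite ffunE.
have <- : xget 1 (codes c) = f.
  apply: xget_unique => // g cg; apply: aut_gen_inj => i; apply: val_inj.
  by rewrite cg cf.
exact: (leq_bigmax (F := F) c).
Qed.

Lemma out_normP (r : nat) (P : out (free_group r)) :
  (exists2 f : aut (free_group r), out_set P f & aut_norm f = out_norm P) /\
  forall f : aut (free_group r), out_set P f -> (out_norm P <= aut_norm f)%N.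
Proof.
have [f0 Pf0] : out_set P !=set0.
  have [f ->] := out_setP P; exists f.
  by apply/inn_cosetP; exists 1; rewrite inner1 mulg1.
have ne : [set aut_norm f | f in out_set P] !=set0.
  by exists (aut_norm f0); exists f0.
have [[f Pf fE] Pmin] := set_minP ne; split; first by exists f.
by move=> g Pg; apply: Pmin; exists g.
Qed.

Lemma alpha_max (r n : nat) (f : aut (free_group r)) :
    (aut_norm f <= n)%N ->
  (exists2 g : aut (free_group r),
     (aut_norm g <= n)%N & aut_norm g^-1 = alpha r n) /\
  (aut_norm f^-1 <= alpha r n)%N.
Proof.
move=> fn; have [b bP] := aut_norm_bounded r n.
pose A := [set aut_norm f^-1 | f in
  [set f : aut (free_group r) | (aut_norm f <= n)%N]].
have [|k [g gn <-]|[g gn gE] Amax] := @set_maxP A b.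
- by exists (aut_norm f^-1); exists f.
- exact: bP.
by split; [exists g | apply: Amax; exists f].
Qed.

Lemma beta_max (r n : nat) (P : out (free_group r)) :
    (out_norm P <= n)%N ->
  (exists2 Q : out (free_group r),
     (out_norm Q <= n)%N & out_norm Q^-1 = beta r n) /\
  (out_norm P^-1 <= beta r n)%N.
Proof.
move=> Pn; have [b bP] := aut_norm_bounded r n.
pose B := [set out_norm P^-1 | P in
  [set P : out (free_group r) | (out_norm P <= n)%N]].
have [|k [Q /= Qn <-]|[Q Qn QE] Bmax] := @set_maxP B b.
- by exists (out_norm P^-1); exists P.
- have [[f Qf fE] _] := out_normP Q; have [_ /(_ f^-1) le] := out_normP Q^-1.
  by apply: leq_trans (le _) (bP _ _); [exists f | rewrite fE].
by split; [exists Q | apply: Bmax; exists P].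
Qed.

(* An automorphism sends every basis element to a nontrivial element, so it has
   norm at least r; hence alpha r n = beta r n = 0 for n < r, and a lower bound
   K * n ^ k with K > 0 cannot hold in the range 0 < n < r. *)

Lemma aut_norm_ge (r : nat) (f : aut (free_group r)) : (r <= aut_norm f)%N.
Proof.
rewrite /aut_norm -{1}(card_ord r) -sum1_card; apply: leq_sum => i _.
rewrite lt0n; apply/negP => /nilP e.
have h : f (gen i) = f (1 : free_group r) by rewrite aut1; apply: val_inj.
by move/(bij_inj (aut_bij f))/(congr1 val): h.
Qed.

Lemma alpha_eq0 (r n : nat) : (n < r)%N -> alpha r n = 0%N.
Proof.
move=> nr; apply: xgetPN => m [[f fn _] _].
by move: (leq_trans (aut_norm_ge f) fn); rewrite leqNgt nr.
Qed.

Lemma beta_eq0 (r n : nat) : (n < r)%N -> beta r n = 0%N.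
Proof.
move=> nr; apply: xgetPN => m [[P Pn _] _].
have [[f _ fE] _] := out_normP P; move: Pn; rewrite /= -fE => fn.
by move: (leq_trans (aut_norm_ge f) fn); rewrite leqNgt nr.
Qed.

(* Main.v *)
Require Import Defs.
From mathcomp Require Import all_boot all_order all_algebra.
From mathcomp Require Import reals exp.
From mathcomp Require Import boolp zify.
Set Implicit Arguments.
Unset Strict Implicit.
Unset Printing Implicit Defensive.
Import Order.TTheory GRing.Theory Num.Theory.
Local Open Scope ring_scope.

(** The lower bounds come from the automorphism that sends [a_i] to
   [a_(i-1) ^ (- k) a_i] ([tower_aut]): its norm is linear in [k], whereas its
   inverse sends the last generator to a positive word of length at least
   [k ^ (r - 1)], and positivity prevents any conjugation from shortening it
   ([beta_lower]).  Composing with the conjugation by the [k]-th power of the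
   last generator gains one more factor [k] in the automorphism group
   ([alpha_lower]).

   The upper bound holds for automorphisms, and hence for outer automorphisms.
   Given [f], subdivide the rose so that its petals spell the images of the
   basis; the number of its edges is the norm of [f], and it maps to the standard
   rose by a homotopy equivalence, which factors into Stallings folds, each of
   which removes an edge.  The value of the inverse of [f] on a generator is read
   off the loop of the subdivided rose that lies over a petal of the standard
   rose.  So one has to control how much a loop lengthens when a fold is undone.

   A reduced loop that folds to length [l] and crosses the folded turn [m] times
   has length [l + 2 m] ([nfold_spec]), which is harmless if [m] is at most two.
   Otherwise some crossing lies between two loops of total length at most a
   constant times [l / m] ([short_crossing]).  These two short loops are used to
   build a short cycle modulo two in the cover of the graph associated with the
   first homology modulo two of the free group, passing through two edges that
   the fold identifies ([odd_loop_turn], [short_cycle]).  The first homology of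
   the graph itself would not do: if the folded edges separate the two loops,
   then no cycle of the graph crosses them, but the lift of a commutator of the
   two loops does.

   Chains modulo two never get larger in a fold, and this cycle loses two edges.
   The cycles of the cover realize chains of the cover of the standard rose
   ([realize]), which are finite in number and do not depend on the graph.  The
   product of the sizes of all these realizations (plus one) is a [potential],
   which never increases along the folding sequence and is bounded at the
   beginning by a polynomial in the norm of [f].  The proportion [m / l] by which
   the loop lengthens is at most a constant times the proportion by which the
   potential drops ([fold_length]), so the total lengthening is at most a power of
   the initial potential, up to the additive contributions of the folds with at
   most two crossings ([short_petals], [inverse_polynomial]). *)

(** * Words and their values in a group *)

Section Words.
Local Open Scope nat_scope.
Local Open Scope group_scope.
Variable k : nat.
Implicit Types (a b : letter k) (u v w : seq (letter k)).

(** The reduced form of a word; two words denote the same element of the free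
   group when their reduced forms agree. *)
Definition nf w := word_mul w [::].

Lemma letterV_inj : injective (@letterV k).
Proof. exact: inv_inj (@letterVK k). Qed.

Lemma letter_edge a b : a.1 = b.1 -> a = b \/ a = letterV b.
Proof.
by case: a b => [i c] [j d] /= ->; case: c; case: d; [left|right|right|left].
Qed.

Lemma reduced_nf w : reduced (nf w).
Proof. exact: reduced_mul. Qed.

Lemma nf_id w : reduced w -> nf w = w.
Proof. exact: word_mul1. Qed.

Lemma nf_cat u v : nf (u ++ v) = word_mul u (nf v).
Proof. exact: word_mul_cat. Qed.

Lemma word_mul_nf u v : reduced v -> word_mul (nf u) v = word_mul u v.
Proof. by move=> rv; rewrite /nf -word_mulA. Qed.

Lemma nf_catl u v : nf (nf u ++ v) = nf (u ++ v).
Proof. by rewrite !nf_cat word_mul_nf ?reduced_nf. Qed.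

Lemma nf_catr u v : nf (u ++ nf v) = nf (u ++ v).
Proof. by rewrite !nf_cat (nf_id (reduced_nf v)). Qed.

Lemma size_push a w : size (push a w) <= (size w).+1.
Proof. by case: w => //= b w; case: ifP => _ //=; rewrite leqW. Qed.

Lemma size_nf w : size (nf w) <= size w.
Proof.
elim: w => //= a w IH; exact: leq_trans (size_push _ _) _.
Qed.

Lemma word_inv_cat u v : word_inv (u ++ v) = word_inv v ++ word_inv u.
Proof. by rewrite /word_inv map_cat rev_cat. Qed.

Lemma word_inv_cons a w : word_inv (a :: w) = word_inv w ++ [:: letterV a].
Proof. by rewrite -cat1s word_inv_cat. Qed.

Lemma size_word_inv w : size (word_inv w) = size w.
Proof. by rewrite size_rev size_map. Qed.

Lemma nf_mulV w : nf (word_inv w ++ w) = [::].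
Proof. by rewrite nf_cat -[nf w]/(word_mul w [::]) word_mulVr. Qed.

Lemma nf_eq_of_mulV u v : nf (u ++ word_inv v) = [::] -> nf u = nf v.
Proof.
move=> uv; rewrite -[in LHS](cats0 u) -(nf_mulV v) nf_catr catA.
by rewrite -nf_catl uv.
Qed.

Lemma reduced_cat u v : reduced (u ++ v) -> reduced u /\ reduced v.
Proof. by move=> /cat_sorted2[]. Qed.

Section Value.
Variables (G : groupType) (g : 'I_k -> G).

Definition lval a := if a.2 then g a.1 else (g a.1)^-1.
Definition wval w := foldr (fun a x => lval a * x) 1 w.

Lemma lvalV a : lval (letterV a) = (lval a)^-1.
Proof. by case: a => i [] //=; rewrite /lval /= invgK. Qed.

Lemma wval_cat u v : wval (u ++ v) = wval u * wval v.
Proof. by elim: u => [|a u /= ->]; rewrite ?mul1g ?mulgA. Qed.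

Lemma wval_inv w : wval (word_inv w) = (wval w)^-1.
Proof.
elim: w => [|a w IH]; first by rewrite invg1.
by rewrite word_inv_cons wval_cat IH /= mulg1 lvalV invgM.
Qed.

Lemma wval_push a w : wval (push a w) = lval a * wval w.
Proof.
case: w => //= b w; case: ifP => //= /eqP ->.
by rewrite lvalV mulVKg.
Qed.

Lemma wval_mul u v : wval (word_mul u v) = wval u * wval v.
Proof. by elim: u => [|a u IH] /=; rewrite ?mul1g // wval_push IH mulgA. Qed.

Lemma wval_nf w : wval (nf w) = wval w.
Proof. by rewrite wval_mul mulg1. Qed.

Lemma wval_eq u v : nf u = nf v -> wval u = wval v.
Proof. by move=> uv; rewrite -wval_nf uv wval_nf. Qed.

End Value.

Lemma val_wval_gen w : val (wval (@gen k) w) = nf w.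
Proof.
elim: w => //= a w IH; rewrite /nf /= -/(nf w) -IH.
by case: a => i [].
Qed.

Lemma wval_gen (x : free_group k) : wval (@gen k) (val x) = x.
Proof. by apply: val_inj; rewrite val_wval_gen nf_id // (valP x). Qed.

Lemma wval_gen_eq u v : wval (@gen k) u = wval (@gen k) v -> nf u = nf v.
Proof. by move=> uv; rewrite -!val_wval_gen uv. Qed.

Lemma wlenM (x y : free_group k) : wlen (x * y) <= wlen x + wlen y.
Proof.
rewrite /wlen /=; elim: (val x) => //= a u IH.
by apply: leq_trans (size_push _ _) _.
Qed.

Lemma wlenV (x : free_group k) : wlen x^-1 = wlen x.
Proof. exact: size_word_inv. Qed.

End Words.

Lemma wval_comp k (G G' : groupType) (g : 'I_k -> G) (h : G -> G') w :
  {morph h : x y / (x * y)%g} -> h (wval g w) = wval (h \o g) w.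
Proof.
move=> hM.
have h1 : h 1%g = 1%g by apply: (@mulgI _ (h 1%g)); rewrite -hM !mulg1.
have hV x : h x^-1%g = (h x)^-1%g.
  by apply: (@mulgI _ (h x)); rewrite -hM !mulgV.
by elim: w => //= a w IH; rewrite hM IH /lval; case: a => i [] /=; rewrite ?hV.
Qed.

Lemma eq_wval k (G : groupType) (g h : 'I_k -> G) : g =1 h -> wval g =1 wval h.
Proof. by move=> gh; elim=> //= a w ->; rewrite /lval gh. Qed.

(** * Labelled graphs and their walks *)

Section Graphs.
Local Open Scope nat_scope.
Local Open Scope group_scope.
Variables (k r : nat) (V : finType) (lab : 'I_k -> 'I_r).
Implicit Types (a b : letter k) (u v w : seq (letter k)) (x y z : V).

(** A graph over the rose with petals indexed by ['I_r], together with a walk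
   for each petal.  The types of edges and of vertices are fixed once and for
   all and only some edges are active, so that a fold merely deactivates an edge
   and redirects the others. *)
Record graph : Type := Graph {
  active : {set 'I_k};
  esrc : 'I_k -> V;
  etgt : 'I_k -> V;
  base : V;
  petal : 'I_r -> seq (letter k) }.

Implicit Type G : graph.

Definition src G a := if a.2 then esrc G a.1 else etgt G a.1.
Definition tgt G a := src G (letterV a).

Fixpoint walk G x w y : bool :=
  if w is a :: w' then [&& a.1 \in active G, src G a == x & walk G (tgt G a) w' y]
  else x == y.

Definition ev w : free_group r := wval (fun e => gen (lab e)) w.

(** The image of [z] under the homomorphism that sends the generators to [W]. *)
Definition subst_word (W : 'I_r -> seq (letter k)) (z : seq (letter r)) :=
  flatten [seq (if c.2 then W c.1 else word_inv (W c.1)) | c <- z].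

(** The labelling induces an isomorphism from the fundamental group at the base
   point onto the free group, the petals being the preimages of the basis. *)
Record marked G : Prop := Marked {
  marked_inj : forall x w, walk G x w x -> ev w = 1 -> nf w = [::];
  marked_walk : forall i, walk G (base G) (petal G i) (base G);
  marked_ev : forall i, ev (petal G i) = gen i }.

Lemma tgtV G a : tgt G (letterV a) = src G a.
Proof. by rewrite /tgt letterVK. Qed.

Lemma walk_catI G x u y v z :
  walk G x u y -> walk G y v z -> walk G x (u ++ v) z.
Proof.
elim: u x => [|a u IH] x /=; first by move/eqP->.
by move=> /and3P[-> -> /IH h] /h.
Qed.

Lemma walk_catE G x u v z :
  walk G x (u ++ v) z -> exists2 y, walk G x u y & walk G y v z.
Proof.
elim: u x => [|a u IH] x /=; first by exists x.
by move=> /and3P[aA sa /IH[y wu wv]]; exists y => //; rewrite aA sa.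
Qed.

Lemma walk1 G a : a.1 \in active G -> walk G (src G a) [:: a] (tgt G a).
Proof. by move=> aA /=; rewrite aA !eqxx. Qed.

Lemma walk_inv G x w y : walk G x w y -> walk G y (word_inv w) x.
Proof.
elim: w x => [|a w IH] x /=; first by rewrite eq_sym.
move=> /and3P[aA /eqP<- /IH wi]; rewrite word_inv_cons.
apply: walk_catI wi _; rewrite -tgtV; exact: walk1.
Qed.

Lemma walk_push G x a w y : walk G x (a :: w) y -> walk G x (push a w) y.
Proof.
case: w => //= b w; case: ifP => // /eqP -> /and5P[_ /eqP<- _ _].
by rewrite tgtV.
Qed.

Lemma walk_nf G x w y : walk G x w y -> walk G x (nf w) y.
Proof.
elim: w x => //= a w IH x /and3P[aA sa /IH wn].
by apply: walk_push => /=; rewrite aA sa.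
Qed.

Lemma ev_cat u v : ev (u ++ v) = ev u * ev v.
Proof. exact: wval_cat. Qed.

Lemma ev_inv u : ev (word_inv u) = (ev u)^-1.
Proof. exact: wval_inv. Qed.

Lemma ev_nf u : ev (nf u) = ev u.
Proof. exact: wval_nf. Qed.

Lemma ev_label w : ev w = wval (@gen r) [seq (lab a.1, a.2) | a <- w].
Proof. by elim: w => //= a w <-. Qed.

Lemma wval_subst (H : groupType) (g : 'I_k -> H) W (z : seq (letter r)) :
  wval g (subst_word W z) = wval (fun i => wval g (W i)) z.
Proof.
elim: z => //= c z IH; rewrite /subst_word /= wval_cat -/(subst_word W z) IH /lval.
by case: c.2; rewrite ?wval_inv.
Qed.

Lemma walk_substI G x W (z : seq (letter r)) :
  (forall i, walk G x (W i) x) -> walk G x (subst_word W z) x.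
Proof.
move=> Wx; elim: z => [|c z IH]; first exact: eqxx.
by apply: walk_catI IH; case: c.2; [|apply: walk_inv]; apply: Wx.
Qed.

Lemma walk_subst G (z : seq (letter r)) :
  marked G -> walk G (base G) (subst_word (petal G) z) (base G).
Proof. by move=> mG; apply: walk_substI; apply: marked_walk. Qed.

Lemma ev_subst G (z : seq (letter r)) :
  marked G -> ev (subst_word (petal G) z) = wval (@gen r) z.
Proof.
move=> mG; rewrite /ev wval_subst; apply: eq_wval => i; exact: marked_ev.
Qed.

(** Since the labelling is injective on homotopy classes, a closed walk at the
   base point is determined by its label, hence is spelled by the petals. *)
Lemma nf_subst G w : marked G -> walk G (base G) w (base G) ->
  nf w = nf (subst_word (petal G) (val (ev w))).
Proof.
move=> mG ww; apply: nf_eq_of_mulV; apply: (marked_inj mG (x := base G)).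
  by apply: walk_catI ww _; apply/walk_inv/walk_subst.
by rewrite ev_cat ev_inv ev_subst // wval_gen mulgV.
Qed.

End Graphs.

(** * Chains modulo two in a finite abelian cover *)

Lemma F2_addxx (x : 'F_2) : x + x = 0.
Proof.
by rewrite -mulr2n -[x *+ 2]mulr_natr (_ : 2%:R = 0) ?mulr0 //; apply: val_inj.
Qed.

Lemma F2_neq0 (x : 'F_2) : x != 0 -> x = 1.
Proof. by case: x => [[|[|m]] //] hm _; apply: val_inj. Qed.

Section Chains.
Variables (k r : nat) (lab : 'I_k -> 'I_r).
Implicit Types (a b : letter k) (u v w : seq (letter k)) (e : 'I_k).

Notation H := 'rV['F_2]_r.
Notation chains := {ffun 'I_k * H -> 'F_2}.
Implicit Types (g h : H).

Lemma H_addxx h : h + h = 0.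
Proof. by apply/rowP => i; rewrite !mxE F2_addxx. Qed.

Lemma H_addK h g : h + g + g = h.
Proof. by rewrite -addrA H_addxx addr0. Qed.

Lemma H_add_eq0 h g : (h + g == 0) = (h == g).
Proof.
by rewrite -{2}(add0r g) -[X in _ = (X == _)](H_addK h g) (inj_eq (addIr g)).
Qed.

Lemma chains_addxx (x : chains) : x + x = 0.
Proof. by apply/ffunP => p; rewrite !ffunE F2_addxx. Qed.

Lemma chainsD (x y : chains) p : (x + y) p = x p + y p.
Proof. by rewrite ffunE. Qed.

(** The group ['rV['F_2]_r] is the first homology modulo two of the rose; it
   acts on the corresponding cover, whose edges over [e] are the pairs [(e, h)],
   starting at level [h] and ending at level [h + step e]. *)
Definition step e : H := delta_mx 0 (lab e).
Definition shift w : H := \sum_(a <- w) step a.1.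

(** The edge traversed by the letter [a] of a walk that has reached level [h]. *)
Definition ledge h a : 'I_k * H := (a.1, if a.2 then h else h + step a.1).
Definition cell (p : 'I_k * H) : chains := [ffun q => (q == p)%:R].

(** The chain modulo two of the lift of [w] that starts at level [h]. *)
Fixpoint chain h w : chains :=
  if w is a :: w' then cell (ledge h a) + chain (h + step a.1) w' else 0.

(** The chain modulo two of [w] in the graph itself. *)
Definition parity w e : 'F_2 := (count (fun a => a.1 == e) w)%:R.

Lemma shift_cat u v : shift (u ++ v) = shift u + shift v.
Proof. exact: big_cat. Qed.

Lemma shift_cons a w : shift (a :: w) = step a.1 + shift w.
Proof. exact: big_cons. Qed.

Lemma shift1 a : shift [:: a] = step a.1.
Proof. exact: big_seq1. Qed.

Lemma shift_nil : shift [::] = 0.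
Proof. exact: big_nil. Qed.

Lemma shift_inv w : shift (word_inv w) = shift w.
Proof.
elim: w => // a w IH.
by rewrite word_inv_cons shift_cat IH shift1 shift_cons addrC.
Qed.

Lemma shift_push a w : shift (push a w) = step a.1 + shift w.
Proof.
case: w => [|b w]; first by rewrite shift1 shift_nil addr0.
rewrite /=; case: ifP => [/eqP->|_]; last by rewrite shift_cons.
by rewrite shift_cons addrA H_addxx add0r.
Qed.

Lemma shift_nf w : shift (nf w) = shift w.
Proof. by elim: w => // a w IH; rewrite shift_cons -IH -shift_push. Qed.

Lemma chain_cat h u v : chain h (u ++ v) = chain h u + chain (h + shift u) v.
Proof.
elim: u h => [|a u IH] h /=; first by rewrite shift_nil addr0 add0r.
by rewrite IH shift_cons !addrA.
Qed.

Lemma ledgeV h a : ledge (h + step a.1) (letterV a) = ledge h a.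
Proof. by rewrite /ledge; case: a => i [] //=; rewrite H_addK. Qed.

Lemma chain_inv h w : chain (h + shift w) (word_inv w) = chain h w.
Proof.
elim: w h => //= a w IH h.
rewrite word_inv_cons chain_cat shift_cons [h + (_ + _)]addrA IH shift_inv.
rewrite H_addK /= addr0.
by rewrite ledgeV [LHS]addrC.
Qed.

Lemma chain_push h a w : chain h (push a w) = chain h (a :: w).
Proof.
case: w => //= b w; case: ifP => //= /eqP ->.
by rewrite ledgeV H_addK addrA chains_addxx add0r.
Qed.

Lemma chain_nf h w : chain h (nf w) = chain h w.
Proof.
by elim: w h => // a w IH h; rewrite -[nf _]/(push a (nf w)) chain_push /= IH.
Qed.

Lemma chain_translate g h w e x : chain (h + g) w (e, x + g) = chain h w (e, x).
Proof.
elim: w h => [|a w IH] h; first by rewrite !ffunE.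
rewrite /= !ffunE addrAC IH; congr (_%:R + _).
rewrite /ledge !xpair_eqE; case: a.2; rewrite ?(inj_eq (addIr g)) //.
by rewrite addrAC (inj_eq (addIr g)).
Qed.

Lemma sum_chain h w e : \sum_g chain h w (e, g) = parity w e.
Proof.
elim: w h => [|a w IH] h; first by rewrite big1 // => g _; rewrite ffunE.
under eq_bigr do rewrite /= !ffunE.
rewrite big_split /= IH /parity /= natrD; congr (_ + _).
rewrite (bigD1 (ledge h a).2) //= big1 ?addr0 => [|g /negPf ng].
  by rewrite /ledge xpair_eqE eqxx andbT eq_sym.
by rewrite /ledge xpair_eqE ng andbF.
Qed.

Lemma parity_cat u v e : parity (u ++ v) e = parity u e + parity v e.
Proof. by rewrite /parity count_cat natrD. Qed.

Lemma parity_cons a w e : parity (a :: w) e = (a.1 == e)%:R + parity w e.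
Proof. by rewrite /parity /= natrD. Qed.

Lemma parity_inv w e : parity (word_inv w) e = parity w e.
Proof.
by rewrite /parity /word_inv count_rev count_map.
Qed.

Lemma parity_nf w e : parity (nf w) e = parity w e.
Proof. by rewrite -!(sum_chain 0) chain_nf. Qed.

Lemma parity_notin w e : e \notin map fst w -> parity w e = 0.
Proof.
rewrite /parity => ew; rewrite (_ : count _ _ = 0%N) //.
by apply/eqP; rewrite -leqn0 leqNgt -has_count -(has_map fst (pred1 e)) has_pred1.
Qed.

Lemma chain_notin h w e g : e \notin map fst w -> chain h w (e, g) = 0.
Proof.
elim: w h => [|a w IH] h /=; first by rewrite ffunE.
rewrite inE negb_or => /andP[/negPf ea ew]; rewrite !ffunE IH // addr0.
by rewrite /ledge xpair_eqE ea.
Qed.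

End Chains.

Section Realization.
Variables (k r : nat) (V : finType) (lab : 'I_k -> 'I_r).
Notation H := 'rV['F_2]_r.
Implicit Types (W : 'I_r -> seq (letter k)) (G : graph k r V).

(** The linear map from chains in the cover of the rose to chains in the cover
   of a graph that sends each petal of the rose to the walk spelling it. *)
Definition realize W (c : {ffun 'I_r * H -> 'F_2}) : {ffun 'I_k * H -> 'F_2} :=
  [ffun q => \sum_p c p * chain lab p.2 (W p.1) q].

Lemma realizeD W c c' : realize W (c + c') = realize W c + realize W c'.
Proof.
apply/ffunP => q; rewrite !ffunE -big_split; apply: eq_bigr => p _.
by rewrite !ffunE mulrDl.
Qed.

Lemma realize0 W : realize W 0 = 0.
Proof. by apply/ffunP => q; rewrite !ffunE big1 // => p _; rewrite ffunE mul0r. Qed.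

Lemma realize_cell W p : realize W (cell p) = chain lab p.2 (W p.1).
Proof.
apply/ffunP => q; rewrite ffunE (bigD1 p) //= ffunE eqxx mul1r big1 ?addr0 //.
by move=> p' /negPf np; rewrite ffunE np mul0r.
Qed.

(** This is the chain rule of the free differential calculus, reduced modulo two
   and to the first homology. *)
Lemma chain_subst W h (z : seq (letter r)) :
    (forall i, shift lab (W i) = delta_mx 0 i) ->
  chain lab h (subst_word W z) = realize W (chain id h z).
Proof.
move=> Wi; elim: z h => [|c z IH] h; first by rewrite realize0.
rewrite /subst_word /= chain_cat -/(subst_word W z) realizeD realize_cell.
have -> : shift lab (if c.2 then W c.1 else word_inv (W c.1)) = step id c.1.
  by case: c.2; rewrite ?shift_inv Wi.
rewrite IH; congr (_ + _); rewrite /ledge /=; case: c.2 => //=.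
by rewrite -[LHS](chain_inv _ _ (word_inv _)) word_invK shift_inv Wi.
Qed.

Lemma parity_subst W (z : seq (letter r)) e :
  parity (subst_word W z) e = \sum_i shift id z 0 i * parity (W i) e.
Proof.
elim: z => [|c z IH].
  by rewrite shift_nil big1 // => i _; rewrite mxE mul0r.
rewrite /subst_word /= parity_cat -/(subst_word W z) IH shift_cons.
under [RHS]eq_bigr do rewrite mxE mulrDl.
rewrite big_split; congr (_ + _); rewrite (bigD1 c.1) //= big1 ?addr0.
  by rewrite mxE !eqxx mul1r; case: c.2; rewrite ?parity_inv.
by move=> i /negPf ni; rewrite mxE ni andbF mul0r.
Qed.

Lemma shift_ev w : shift lab w = shift id (val (ev lab w)).
Proof.
rewrite ev_label val_wval_gen shift_nf; elim: w => [|a w IH].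
  by rewrite !shift_nil.
by rewrite /= !shift_cons IH.
Qed.

Lemma marked_shift G i : marked lab G -> shift lab (petal G i) = delta_mx 0 i.
Proof. by move=> mG; rewrite shift_ev (marked_ev mG) shift1. Qed.

(** The chain of a loop depends linearly on the chain of its label in the cover
   of the rose.  Hence finitely many chains of that fixed cover account for all
   the loops that close up in the cover of [G], whatever the graph [G]. *)
Lemma chain_closed G w : marked lab G -> walk G (base G) w (base G) ->
  chain lab 0 w = realize (petal G) (chain id 0 (val (ev lab w))).
Proof.
move=> mG ww; rewrite -chain_nf (nf_subst mG ww) chain_nf chain_subst //.
by move=> i; apply: marked_shift.
Qed.

(** The marking identifies the first homology modulo two of the graph with that
   of the rose, and a graph has no boundaries of dimension one. *)
Lemma parity_closed G w : marked lab G -> walk G (base G) w (base G) ->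
  shift lab w = 0 -> parity w =1 (fun=> 0).
Proof.
move=> mG ww w0 e; rewrite -(parity_nf lab) (nf_subst mG ww) (parity_nf lab).
by rewrite parity_subst -shift_ev w0 big1 // => i _; rewrite mxE mul0r.
Qed.

End Realization.

(** * Loops of a graph that are odd on a given edge of the cover *)

Section OddLoops.
Variables (k r : nat) (V : finType) (lab : 'I_k -> 'I_r).
Notation H := 'rV['F_2]_r.
Implicit Types (G : graph k r V) (u v w : seq (letter k)) (x y : V).
Implicit Types (N : {set 'I_k}) (e : 'I_k) (a b : letter k).

Definition inside N w := all (fun a => a.1 \in N) w.

Lemma inside_cat N u v : inside N (u ++ v) = inside N u && inside N v.
Proof. exact: all_cat. Qed.

Lemma inside_inv N w : inside N (word_inv w) = inside N w.
Proof. by rewrite /inside all_rev all_map. Qed.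

Lemma insideD1 N w e :
  inside N w -> e \notin map fst w -> inside (N :\ e) w.
Proof.
elim: w => //= a w IH /andP[aN wN]; rewrite inE negb_or => /andP[ae ew].
by rewrite !inE aN andbT eq_sym ae; apply: IH.
Qed.

Lemma insideD1_notin N w e : inside (N :\ e) w -> e \notin map fst w.
Proof.
elim: w => //= a w IH /andP[]; rewrite !inE => /andP[ae _] /IH.
by rewrite negb_or eq_sym ae.
Qed.

Lemma insideS N N' w : N \subset N' -> inside N w -> inside N' w.
Proof. by move=> /subsetP NN; apply: sub_all => a; apply: NN. Qed.

Lemma first_occurrence e w : e \in map fst w ->
  exists u b v, [/\ w = u ++ b :: v, b.1 = e & e \notin map fst u].
Proof.
elim: w => //= a w IH; rewrite inE.
have [-> _|ea /= /IH[u [b [v [-> be eu]]]]] := eqVneq e a.1.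
  by exists [::], a, w.
by exists (a :: u), b, v; rewrite /= inE negb_or ea.
Qed.

Lemma parity_conj a w e : parity (a :: w ++ [:: letterV a]) e = parity w e.
Proof.
rewrite parity_cons parity_cat parity_cons [parity [::] e](_ : _ = 0) //= addr0.
by rewrite addrCA F2_addxx addr0.
Qed.

(** The first edge of the walk either occurs an odd number of times in a
   closed initial segment, or is immediately retraced after a shorter closed
   reduced walk, to which the same argument applies. *)
Lemma reduced_loop_odd G N x w :
    walk G x w x -> reduced w -> w != [::] -> inside N w ->
  exists u e, [/\ walk G x u x, inside N u & parity u e != 0].
Proof.
elim: {w}(size w) {-2}w (leqnn (size w)) x => [|n IH] w.
  by rewrite leqn0 => /nilP->.
case: w => // a w /= wn x /and3P[aA /eqP ax wa] raw _ /andP[aN wN].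
have [|aw] := boolP (a.1 \in map fst w); last first.
  exists (a :: w), a.1; split; rewrite /= ?aA ?ax ?eqxx ?aN //.
  by rewrite parity_cons eqxx parity_notin // addr0.
move=> /first_occurrence[u [b [v [wE ba au]]]]; move: wn wa raw wN; rewrite wE.
move=> wn /walk_catE[y wu /= /and3P[_ /eqP sb _]] raw.
rewrite inside_cat => /andP[uN _].
have [ab|ab] := eqVneq b a.
  exists (a :: u), a.1; split; rewrite /= ?aA ?ax ?eqxx ?aN //.
    by rewrite -ax -ab sb ab.
  by rewrite parity_cons eqxx parity_notin // addr0.
have {ab} bE : b = letterV a.
  case: b a ba ab {sb wE wu aA ax aN au wn raw} => [i c] [j d] /= -> nij.
  by congr (_, _); case: c d nij => [] [] //=; rewrite eqxx.
have uE : u != [::].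
  by apply: contraTneq raw => -> /=; rewrite bE eqxx.
have wu' : walk G (tgt G a) u (tgt G a) by move: wu; rewrite -sb bE.
have ru : reduced u.
  have [] := @reduced_cat _ (a :: u) (b :: v) raw.
  by move=> /reduced_behead.
have su : (size u <= n)%N by move: wn; rewrite size_cat /=; lia.
have [u' [e [wu1 u'N ue]]] := IH u su _ wu' ru uE uN.
exists (a :: u' ++ [:: letterV a]), e; split.
- rewrite /= aA ax eqxx /=; apply: walk_catI wu1 _.
  by rewrite /= aA !eqxx tgtV ax eqxx.
- by rewrite /= aN inside_cat u'N /= aN.
- by rewrite parity_conj.
Qed.

Lemma reach_esrc G N x y w e :
    walk G x w y -> inside N w -> e \in map fst w ->
  exists2 u, walk G x u (esrc G e) & inside N u.
Proof.
move=> ww wN /first_occurrence[u [[i c] [v [wE /= ie _]]]]; subst i.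
move: ww wN; rewrite wE => /walk_catE[z wu /= /and3P[eA /eqP sz _]].
rewrite inside_cat /= => /and3P[uN eN _]; clear wE; case: c sz => sz.
  by exists u => //; rewrite -sz in wu.
exists (u ++ [:: (e, false)]); last by rewrite inside_cat uN /= eN.
by apply: walk_catI wu _; rewrite /= eA sz !eqxx.
Qed.

Section Marked.
Variable G : graph k r V.
Hypothesis mG : marked lab G.
Variables (x : V) (p : seq (letter k)).
Hypothesis px : walk G (base G) p x.

Lemma parity_loop w : walk G x w x -> shift lab w = 0 -> parity w =1 (fun=> 0).
Proof.
move=> ww w0 e; have wp : walk G (base G) (p ++ w ++ word_inv p) (base G).
  by apply: walk_catI px _; apply: walk_catI ww _; apply: walk_inv.
have := parity_closed mG wp; rewrite !shift_cat w0 shift_inv add0r H_addxx.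
move=> /(_ erefl e); rewrite !parity_cat parity_inv addrCA.
by rewrite F2_addxx addr0.
Qed.

(** A loop of [G] running inside [N] that closes up in the cover, where it
   crosses some edge over [e] an odd number of times. *)
Definition odd_loop N e := exists w,
  [/\ walk G x w x, inside N w, shift lab w = 0
    & exists g, chain lab 0 w (e, g) != 0].

(** If the square of the loop were even on every lift of the edge, then the
   lifts met by the loop would be paired off by a translation. *)
Lemma odd_loop_square N e w :
  walk G x w x -> inside N w -> parity w e != 0 -> odd_loop N e.
Proof.
move=> ww wN we; exists (w ++ w); split.
- exact: (walk_catI ww ww).
- by rewrite inside_cat wN.
- by rewrite shift_cat H_addxx.
set h := shift lab w.
have [i hi] : exists i, h 0 i != 0.
  apply/existsP; apply: contraNT we => /existsPn h0.
  apply/eqP; apply: (parity_loop ww); apply/rowP => i.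
  by rewrite !mxE; apply/eqP; rewrite -[_ == _]negbK; apply: h0.
have {hi} hi := F2_neq0 hi.
apply/existsP; apply: contraNT we => /existsPn even.
rewrite -(sum_chain lab 0) (bigID (fun g : H => g 0 i == 0)) /=.
rewrite [X in _ + X](reindex_inj (addIr h)) /=.
rewrite [X in _ + X](eq_bigl (fun g : H => g 0 i == 0)) => [|g]; last first.
  by rewrite mxE hi; case: (g 0 i) => [[|[|m]] hm].
rewrite -big_split big1 //= => g _.
have /negPn/eqP := even (g + h); rewrite chain_cat ffunE add0r -/h => h0.
by rewrite -[X in X + _](chain_translate lab h) add0r [LHS]addrC.
Qed.

Lemma chain_conj a w h g : a.1 \notin map fst w ->
  chain lab h (a :: w ++ [:: letterV a]) (a.1, g) =
    (g == (ledge lab h a).2)%:R + (g == (ledge lab (h + shift lab w) a).2)%:R.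
Proof.
move=> aw; rewrite /= chain_cat /= addr0 !ffunE chain_notin // add0r.
by rewrite [h + _ + _]addrAC ledgeV /ledge !xpair_eqE eqxx.
Qed.

(** Suppose that both a reduced loop starting with the letter [a] and one
   starting with another edge run inside [N].  If some loop inside [N] is odd
   on the edge of [a], its square works.  Otherwise this edge separates two
   parts of [N], each of which contains a nontrivial loop, and the commutator
   of these loops crosses four distinct lifts of the edge. *)
Lemma odd_loop_turn N a b u v :
    a.1 != b.1 -> src G a = x -> src G b = x ->
    walk G x (a :: u) x -> reduced (a :: u) -> inside N (a :: u) ->
    walk G x (b :: v) x -> reduced (b :: v) -> inside N (b :: v) ->
  odd_loop N a.1.
Proof.
move=> nab sa sb wau rau auN wbv rbv bvN.
pose odd := exists w, [/\ walk G x w x, inside N w & parity w a.1 != 0].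
have [|even] := pselect odd.
  by case=> w [ww wN we]; apply: odd_loop_square ww wN we.
have aA : a.1 \in active G by move: wau => /= /andP[].
have aN : a.1 \in N by move: auN => /= /andP[].
have odd_arc w : walk G (tgt G a) w x -> inside (N :\ a.1) w -> False.
  move=> ww wN; apply: even; exists (a :: w); split.
  - by rewrite /= aA sa eqxx.
  - by rewrite /= aN; apply: insideS wN; apply: subD1set.
  - by rewrite parity_cons eqxx parity_notin ?addr0 // (insideD1_notin wN).
have wu : walk G (tgt G a) u x by move: wau => /= /and3P[].
have uN : inside N u by move: auN => /= /andP[].
(* The loop starting with [a] comes back through the same edge. *)
have [q [qw rq q0 qN]] : exists q, [/\ walk G (tgt G a) q (tgt G a),
    reduced q, q != [::] & inside (N :\ a.1) q].
  have [/first_occurrence[q [c [t [uE ca aq]]]]|au] := boolP (a.1 \in map fst u);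
    last by case: (odd_arc u); rewrite ?insideD1.
  move: wu uN rau; rewrite uE => /walk_catE[y wq /= /and3P[_ /eqP cy _]].
  rewrite inside_cat => /andP[qN _] rau.
  have [cE|cE] := letter_edge ca.
    by case: (odd_arc q); [rewrite -cy cE sa in wq|exact: insideD1].
  exists q; split; last exact: insideD1.
  - by move: wq; rewrite -cy cE.
  - by have [/reduced_behead] := @reduced_cat _ (a :: q) (c :: t) rau.
  - by apply: contraTneq rau => -> /=; rewrite cE eqxx.
have [t [wt rt t0 tN]] : exists t, [/\ walk G x t x,
    reduced t, t != [::] & inside (N :\ a.1) t].
  have [/first_occurrence[t [c [s [vE ca at_]]]]|av] :=
    boolP (a.1 \in map fst (b :: v)); last by exists (b :: v); rewrite insideD1.
  move: wbv bvN rbv; rewrite vE => /walk_catE[y wt /= /and3P[_ /eqP cy _]].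
  rewrite inside_cat => /andP[tN _] rbv.
  have [cE|cE] := letter_edge ca; last first.
    case: (odd_arc (word_inv t)); last by rewrite inside_inv insideD1.
    by apply: walk_inv; move: wt; rewrite -cy cE.
  exists t; split; last exact: insideD1.
  - by move: wt; rewrite -cy cE sa.
  - by have [] := @reduced_cat _ t (c :: s) rbv.
  - apply/eqP => t0; move: vE; rewrite t0 => -[bc _].
    by rewrite bc ca eqxx in nab.
have [q' [eq [wq q'N qe]]] := reduced_loop_odd qw rq q0 qN.
have [y [ey [wy yN ye]]] := reduced_loop_odd wt rt t0 tN.
have aq' := insideD1_notin q'N.
have ay := insideD1_notin yN.
pose z := a :: q' ++ [:: letterV a].
have wz : walk G x z x.
  by rewrite /= aA sa eqxx; apply: walk_catI wq _; rewrite /= aA !eqxx tgtV sa eqxx.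
have zN : inside N z.
  by rewrite /= aN inside_cat (insideS _ q'N) ?subD1set //= aN.
have {yN} yN' := insideS (subD1set N a.1) yN.
have parz e : parity z e = parity q' e.
  exact: parity_conj.
have shz : shift lab z = shift lab q'.
  by rewrite shift_cons shift_cat shift1 addrC H_addK.
have hz0 : shift lab q' != 0.
  apply: contraNneq qe => h0; rewrite -parz; apply/eqP.
  by apply: (parity_loop wz); rewrite shz.
have hy0 : shift lab y != 0.
  by apply: contraNneq ye => h0; apply/eqP; apply: (parity_loop wy).
have hzy : shift lab q' != shift lab y.
  apply: contraNneq qe => hh; apply/eqP.
  have par0 : parity (z ++ y) eq = 0.
    apply: parity_loop; first exact: (walk_catI wz wy).
    by rewrite shift_cat shz hh H_addxx.
  move: par0; rewrite parity_cat parz.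
  have [ey'|ey'] := boolP (eq \in map fst y); last first.
    by rewrite (parity_notin ey') addr0.
  have [eq'|eq'] := boolP (eq \in map fst q'); last by rewrite (parity_notin eq').
  have [s ws sN] := reach_esrc wq q'N eq'.
  have [s' ws' sN'] := reach_esrc wy (insideD1 yN' ay) ey'.
  case: (odd_arc (s ++ word_inv s')).
    by apply: walk_catI ws _; apply: walk_inv.
  by rewrite inside_cat sN inside_inv.
have cz h g := chain_conj h g aq'; rewrite -/z in cz; clearbody z.
exists (z ++ y ++ word_inv z ++ word_inv y); split.
- apply: (walk_catI wz); apply: (walk_catI wy).
  by apply: (walk_catI (walk_inv wz)); apply: walk_inv.
- by rewrite !inside_cat !inside_inv zN yN'.
- by rewrite !shift_cat !shift_inv addrA H_addxx.
exists (ledge lab 0 a).2; rewrite !chain_cat !add0r.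
rewrite [shift _ z + _]addrC chain_inv !chainsD.
rewrite (chain_notin _ _ _ ay) [chain _ _ (word_inv y) _]chain_notin; last first.
  by rewrite map_rev mem_rev -map_comp.
rewrite !cz add0r addr0 add0r /ledge.
case: (a.2); rewrite /= ?(inj_eq (addIr _)) eqxx ![0 == _]eq_sym;
  by rewrite (negPf hz0) (negPf hy0) H_add_eq0 [_ == shift _ q']eq_sym (negPf hzy).
Qed.

End Marked.
End OddLoops.

(** * Stallings folds *)

Section Fold.
Local Open Scope nat_scope.
Local Open Scope group_scope.
Variables (k r : nat) (V : finType) (lab : 'I_k -> 'I_r).
Variables (G : graph k r V) (a1 a2 : letter k).
Implicit Types (a b c d : letter k) (u v w : seq (letter k)) (x y z : V).

(** The fold of [a2] onto [a1]: the letters [a1] and [a2] have the same source,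
   and their targets are identified. *)
Definition fold_vertex x := if x == tgt G a2 then tgt G a1 else x.
Definition fold_edge e := if e == a2.1 then a1.1 else e.
Definition fold_letter a : letter k := (fold_edge a.1, a.2).

Definition fold : graph k r V :=
  Graph (active G :\ a2.1) (fold_vertex \o esrc G) (fold_vertex \o etgt G)
    (fold_vertex (base G)) (fun i => map fold_letter (petal G i)).

(** Two successive letters of a walk that become inverse to each other. *)
Definition turn a b :=
  (a == letterV a1) && (b == a2) || (a == letterV a2) && (b == a1).

Definition starts w := if w is a :: b :: _ then turn a b else false.

Fixpoint crossings w : nat :=
  if w is a :: w' then (starts w + crossings w')%N else 0%N.

Record foldable : Prop := Foldable {
  foldable_neq : a1 != a2;
  foldable_sign : a1.2 = a2.2;
  foldable_lab : lab a1.1 = lab a2.1;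
  foldable_src : src G a1 = src G a2;
  foldable_active1 : a1.1 \in active G;
  foldable_active2 : a2.1 \in active G }.

Hypotheses (mG : marked lab G) (fG : foldable).

Lemma foldable_edge : a1.1 != a2.1.
Proof.
apply: contra (foldable_neq fG) => /eqP e12.
by rewrite (surjective_pairing a1) e12 (foldable_sign fG) -surjective_pairing.
Qed.

(** Two edges with the same label and the same ends would form a nontrivial
   loop with trivial label. *)
Lemma foldable_tgt : tgt G a1 != tgt G a2.
Proof.
apply/eqP => t12; pose w := [:: a1; letterV a2].
have ww : walk G (src G a1) w (src G a1).
  rewrite /= (foldable_active1 fG) (foldable_active2 fG) !eqxx /=.
  by rewrite tgtV (foldable_src fG) -[src G _]/(tgt G a2) t12 !eqxx.
have /(marked_inj mG ww) : ev lab w = 1.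
  rewrite /ev /= lvalV mulg1 /lval (foldable_lab fG) (foldable_sign fG).
  by rewrite mulgV.
rewrite nf_id //= andbT (inj_eq (@letterV_inj _)) eq_sym.
exact: foldable_neq fG.
Qed.

Lemma fold_letterV a : fold_letter (letterV a) = letterV (fold_letter a).
Proof. by []. Qed.

Lemma fold_letter1 : fold_letter a1 = a1.
Proof. by rewrite /fold_letter /fold_edge (negPf foldable_edge) -surjective_pairing. Qed.

Lemma fold_letter2 : fold_letter a2 = a1.
Proof.
by rewrite /fold_letter /fold_edge eqxx -(foldable_sign fG) -surjective_pairing.
Qed.

Lemma fold_letter_inv w :
  map fold_letter (word_inv w) = word_inv (map fold_letter w).
Proof. by rewrite /word_inv map_rev -!map_comp. Qed.

Lemma ev_fold_letter w : ev lab (map fold_letter w) = ev lab w.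
Proof.
elim: w => //= a w; rewrite /ev /= => ->; congr (_ * _).
rewrite /lval /fold_letter /fold_edge /=; case: eqVneq => //= ->.
by rewrite (foldable_lab fG).
Qed.

Lemma fold_vertex_tgt1 : fold_vertex (tgt G a1) = tgt G a1.
Proof. by rewrite /fold_vertex; case: ifP. Qed.

Lemma fold_vertex_tgt2 : fold_vertex (tgt G a2) = tgt G a1.
Proof. by rewrite /fold_vertex eqxx. Qed.

Lemma src_fold a : src fold a = fold_vertex (src G a).
Proof. by rewrite /src /=; case: a.2. Qed.

Lemma tgt_fold a : tgt fold a = fold_vertex (tgt G a).
Proof. exact: src_fold. Qed.

Lemma src_fold_letter a : src fold (fold_letter a) = fold_vertex (src G a).
Proof.
rewrite src_fold; have [/letter_edge[->|->]|ne] := eqVneq a.1 a2.1.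
- by rewrite fold_letter2 (foldable_src fG).
- rewrite fold_letterV fold_letter2 -![src G _]/(tgt G _).
  by rewrite fold_vertex_tgt1 fold_vertex_tgt2.
- by rewrite /fold_letter /fold_edge (negPf ne) -surjective_pairing.
Qed.

Lemma walk_fold_letter x w y : walk G x w y ->
  walk fold (fold_vertex x) (map fold_letter w) (fold_vertex y).
Proof.
elim: w x => [|a w IH] x; first by move=> /eqP->; apply: eqxx.
move=> /= /and3P[aA /eqP<- /IH]; rewrite src_fold_letter eqxx /tgt.
rewrite -fold_letterV src_fold_letter.
move=> ->; rewrite andbT in_setD1 /fold_edge; case: ifP => [_|ne];
  last by rewrite ne aA.
by rewrite foldable_edge (foldable_active1 fG).
Qed.

Lemma fold_vertex_eq x y : fold_vertex x = fold_vertex y -> exists w,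
  [/\ walk G x w y, ev lab w = 1 & nf (map fold_letter w) = [::]].
Proof.
have side : exists w, [/\ walk G (tgt G a1) w (tgt G a2), ev lab w = 1
    & nf (map fold_letter w) = [::]].
  exists [:: letterV a1; a2]; split.
  - rewrite /= (foldable_active1 fG) (foldable_active2 fG) tgtV.
    by rewrite (foldable_src fG) !eqxx.
  - rewrite /ev /= lvalV mulg1 /lval (foldable_lab fG) (foldable_sign fG).
    by rewrite mulVg.
  - by rewrite /= fold_letterV fold_letter1 fold_letter2 /nf /= letterVK eqxx.
rewrite /fold_vertex; have [->|x2] := eqVneq x (tgt G a2);
  have [->|y2] := eqVneq y (tgt G a2).
- by exists [::]; rewrite /= eqxx.
- move=> <-; have [w [ww w1 wn]] := side; exists (word_inv w); split.
  + exact: walk_inv.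
  + by rewrite ev_inv w1 invg1.
  + apply: (wval_gen_eq (v := [::])); rewrite fold_letter_inv wval_inv -wval_nf wn.
    by rewrite invg1.
- by move=> ->.
- by move=> ->; exists [::]; rewrite /= eqxx.
Qed.

(** Walks lift through a fold: whenever the lift has to jump from one of the
   identified vertices to the other, it backtracks along the folded edges. *)
Lemma walk_unfold w' x y : walk fold (fold_vertex x) w' (fold_vertex y) -> exists w,
  [/\ walk G x w y, ev lab w = ev lab w' & nf (map fold_letter w) = nf w'].
Proof.
elim: w' x => [|a w' IH] x.
  by move=> /= /eqP/fold_vertex_eq[w [ww w1 wn]]; exists w.
move=> /= /and3P[]; rewrite in_setD1 => /andP[a2a aA] /eqP.
rewrite src_fold tgt_fold => /esym/fold_vertex_eq[u [wu u1 un]] /IH[w [ww wE wn]].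
exists (u ++ a :: w); split.
- by apply: walk_catI wu _; rewrite /= aA eqxx.
- by rewrite ev_cat u1 mul1g /ev /= -/(ev lab w) wE.
- have fa : fold_letter a = a.
    by rewrite /fold_letter /fold_edge (negPf a2a) -surjective_pairing.
  by rewrite map_cat -nf_catl un /= fa; congr (push a _).
Qed.

Lemma fold_marked : marked lab fold.
Proof.
split=> [x [|a w]|i|i]; first by [].
- move=> waw e1; have ax : x = fold_vertex (src G a).
    by move: waw => /= /and3P[_ /eqP<- _]; rewrite src_fold.
  rewrite ax in waw; have [w' [ww' wE wn]] := walk_unfold waw.
  rewrite e1 in wE; have := marked_inj mG ww' wE.
  rewrite -wn => w0; apply: (wval_gen_eq (v := [::])).
  have fE u : wval (@gen k) (map fold_letter u) = wval (fun e => gen (fold_edge e)) u.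
    by elim: u => [|b u IH] //; rewrite [LHS]/= IH.
  by rewrite fE -wval_nf w0.
- exact: (walk_fold_letter (marked_walk mG i)).
- by rewrite ev_fold_letter (marked_ev mG).
Qed.

Lemma fold_letter_eq b c : fold_letter b = fold_letter c -> b <> c ->
  [\/ b = a1 /\ c = a2, b = a2 /\ c = a1,
      b = letterV a1 /\ c = letterV a2 | b = letterV a2 /\ c = letterV a1].
Proof.
case: b c => [i s] [j t] [] ij <- {t} nbc.
have eqa a l : a.1 = l -> (l, s) = a \/ (l, s) = letterV a.
  by move=> <-; apply: letter_edge.
have sg a b l m : a.1 = l -> b.1 = m -> a.2 = b.2 ->
    [\/ (l, s) = a /\ (m, s) = b | (l, s) = letterV a /\ (m, s) = letterV b].
  case: a b => [p q] [p' q'] /= -> -> ->.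
  by case: s {nbc eqa}; case: q' => /=; [left|right|right|left].
move: ij nbc; rewrite /fold_edge.
have [i2|i2] := eqVneq i a2.1; have [j2|j2] := eqVneq j a2.1.
- by rewrite i2 j2.
- move=> j1 _; have [] := sg a2 a1 _ _ (esym i2) j1 (esym (foldable_sign fG)).
    by constructor 2.
  by constructor 4.
- move=> i1 _; have [] := sg a1 a2 _ _ (esym i1) (esym j2) (foldable_sign fG).
    by constructor 1.
  by constructor 3.
- by move=> -> [].
Qed.

Lemma fold_letter_turn a b :
  fold_letter b = letterV (fold_letter a) -> src G b = tgt G a ->
  b <> letterV a -> turn a b.
Proof.
have aE c : letterV a = c -> a = letterV c by move=> <-; rewrite letterVK.
rewrite -fold_letterV => /fold_letter_eq ba sb /ba[][bE /aE {}aE]; subst a b.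
- by rewrite /turn !eqxx orbT.
- by rewrite /turn !eqxx.
- by have /eqP[] := foldable_tgt; rewrite /tgt sb tgtV.
- by have /eqP[] := foldable_tgt; rewrite /tgt sb tgtV.
Qed.

Lemma src_turn a b : turn a b -> src G b = tgt G a.
Proof.
by move=> /orP[] /andP[/eqP-> /eqP->]; rewrite tgtV (foldable_src fG).
Qed.

Lemma turn_turn a b c : turn a b -> ~~ turn b c.
Proof.
have s12 := foldable_sign fG.
have no (d d' : letter k) : d.2 = d'.2 -> (d == letterV d') = false.
  by move=> dd; apply/negbTE/eqP => /(congr1 snd) /=; rewrite dd; case: (d'.2).
move=> /orP[] /andP[_ /eqP->]; rewrite /turn !no //.
Qed.

Lemma turn_tgt b c : turn b c -> tgt G c <> src G b.
Proof.
have t12 := foldable_tgt; move=> /orP[]/andP[/eqP-> /eqP->] t21.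
  by rewrite t21 eqxx in t12.
by rewrite t21 eqxx in t12.
Qed.

(** A letter that follows a crossing does not start another one: it would either
   retrace the crossing or start at the wrong target. *)
Lemma turn_next b c d e : turn b c -> src G d = tgt G c -> d <> letterV c ->
  ~~ turn d e.
Proof.
have t12 := foldable_tgt; move=> /orP[]/andP[_ /eqP->] sd dc.
  apply/negP => /orP[]/andP[/eqP dE _]; last by rewrite dE in dc.
  by rewrite dE -[src _ _]/(tgt _ _) in sd; rewrite sd eqxx in t12.
apply/negP => /orP[]/andP[/eqP dE _]; first by rewrite dE in dc.
by rewrite dE -[src _ _]/(tgt _ _) in sd; rewrite sd eqxx in t12.
Qed.

Lemma turn_fold_letter a b c d : turn b c -> src G b = tgt G a -> b <> letterV a ->
  src G d = tgt G c -> d <> letterV c -> fold_letter d <> letterV (fold_letter a).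
Proof.
move=> tbc sb ba sd dc; rewrite -fold_letterV => fda.
have nsb : src G (letterV a) = src G b by rewrite sb.
have nd : d <> letterV a.
  by move=> dE; apply: (turn_tgt tbc); rewrite -sd dE.
have s12 := foldable_src fG.
have ntb := turn_tgt tbc.
have [[dE aE]|[dE aE]|[dE aE]|[dE aE]] := fold_letter_eq fda nd.
- by apply: ntb; rewrite -sd -nsb dE aE.
- by apply: ntb; rewrite -sd -nsb dE aE.
- move: tbc => /orP[]/andP[/eqP bE /eqP cE]; last by rewrite dE cE in dc.
  by have /eqP[] := foldable_tgt; rewrite /tgt -aE -bE.
- move: tbc => /orP[]/andP[/eqP bE /eqP cE]; first by rewrite dE cE in dc.
  by have /eqP[] := foldable_tgt; rewrite /tgt -aE -bE.
Qed.

Lemma crossings_cons a w : crossings (a :: w) = (starts (a :: w) + crossings w)%N.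
Proof. by []. Qed.

Definition nfold w := nf (map fold_letter w).
Arguments nfold : simpl never.
Arguments crossings : simpl never.

Lemma nfold_cons a w : nfold (a :: w) = push (fold_letter a) (nfold w).
Proof. by []. Qed.

Lemma nfold_turn b c w : turn b c -> nfold [:: b, c & w] = nfold w.
Proof.
by move=> /orP[]/andP[/eqP-> /eqP->];
  rewrite !nfold_cons fold_letterV fold_letter1 fold_letter2 pushK ?reduced_nf.
Qed.

(** Folding a reduced walk creates exactly one cancellation for each crossing
   of the folded turn, and the result of these cancellations is reduced: a
   further cancellation would be between two edges that are not identified. *)
Lemma nfold_spec w x y : reduced w -> walk G x w y ->
  (~~ starts w -> ohead (nfold w) = omap fold_letter (ohead w)) /\
  (size (nfold w) + (crossings w).*2 = size w)%N.
Proof.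
elim: {w}(size w) {-2}w (leqnn (size w)) x => [|n IH] [|a w] // wn x.
move=> raw /= /and3P[aA /eqP ax wa].
have rw := reduced_behead raw.
case: w raw rw wa wn => [|b w] // raw rw wab wn.
have [IH2 IH3] := IH (b :: w) wn _ rw wab.
have /= /and3P[_ /eqP sb wb] := wab.
have ba : b <> letterV a by move: raw => /= /andP[/eqP].
have [ab|ab] := boolP (turn a b).
  split=> //; rewrite nfold_turn //.
  have sw : starts (b :: w) = false.
    by case: (w) => // c u; apply/negbTE; apply: turn_turn ab.
  have [_ <-] := IH w (ltnW wn) _ (reduced_behead rw) wb.
  by rewrite !crossings_cons sw /= ab add0n add1n doubleS !addnS.
suff -> : nfold [:: a, b & w] = fold_letter a :: nfold (b :: w).
  by split=> //; rewrite crossings_cons /= (negPf ab) add0n addSn IH3.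
rewrite nfold_cons; have [bw|bw] := boolP (starts (b :: w)); last first.
  case: (nfold (b :: w)) (IH2 bw) => //= c u [->].
  case: eqP => // /fold_letter_turn h; case/negP: ab; exact: h.
case: w bw {IH2 IH3} raw rw wab wn wb => // c w.
rewrite [starts _]/= => bc raw rw wab wn wb.
rewrite nfold_turn //; move: wb => /= /and3P[_ _ wc].
have rcw := reduced_behead rw.
have [IH2 _] := IH w (ltnW (ltnW wn)) _ (reduced_behead rcw) wc.
case: w IH2 {wn raw rw wab} wc rcw => // d w IH2 wc rcw.
have dc : d <> letterV c by move: rcw => /= /andP[/eqP].
have sd : src G d = tgt G c by move: wc => /= /and3P[_ /eqP].
have dw : ~~ starts (d :: w) by case: (w) => // e u; apply: turn_next bc sd dc.
case: (nfold (d :: w)) (IH2 dw) => //= e u [->].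
by case: eqP => // /(turn_fold_letter bc sb ba sd dc).
Qed.

End Fold.

(** * Crossings that are close to each other *)

Section ListSums.
Local Open Scope nat_scope.

Lemma path_sum_lt (R x : nat) (l : seq nat) :
  path (fun y z => R < y + z) x l -> size l * R.+1 + x <= 2 * sumn (x :: l).
Proof.
elim: l x => [|y l IH] x /=; first by lia.
by move=> /andP[xy /IH] /=; lia.
Qed.

Lemma not_path_split (T : Type) (e : rel T) x l : ~~ path e x l ->
  exists l1 y z l2, x :: l = l1 ++ y :: z :: l2 /\ ~~ e y z.
Proof.
elim: l x => //= y l IH x; rewrite negb_and; have [exy|nexy _] := boolP (e x y).
  by move=> /IH[l1 [z [t [l2 [-> nzt]]]]]; exists (x :: l1), z, t, l2.
by exists [::], x, y, l.
Qed.

End ListSums.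

Section Segments.
Local Open Scope nat_scope.
Variables (k r : nat) (V : finType) (lab : 'I_k -> 'I_r).
Variables (G : graph k r V) (a1 a2 : letter k).
Hypotheses (mG : marked lab G) (fG : foldable lab G a1 a2).
Implicit Types (a b c d : letter k) (u v w s t : seq (letter k)) (x y z : V).

Notation turn := (turn a1 a2).
Notation starts := (starts a1 a2).
Notation crossings := (crossings a1 a2).

(** The cut of a word at the crossings of the folded turn. *)
Fixpoint segments w := if w is a :: w' then
    if starts w || nilp w' then [:: a] :: segments w'
    else (a :: head [::] (segments w')) :: behead (segments w')
  else [::].

Lemma segmentsE a b w : exists s ss, segments (a :: b :: w) =
    (if turn a b then [:: [:: a], b :: s & ss] else (a :: b :: s) :: ss)
  /\ segments (b :: w) = (b :: s) :: ss.
Proof.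
suff [s [ss sE]] : exists s ss, segments (b :: w) = (b :: s) :: ss.
  exists s, ss; split=> //; move: sE; rewrite /= orbF => ->.
  by case: ifP.
rewrite /=; case: ifP => _; first by eexists; eexists.
by eexists; eexists.
Qed.

Lemma flatten_segments w : flatten (segments w) = w.
Proof.
elim: w => // a [|b w] IH //; have [s [ss [-> sE]]] := segmentsE a b w.
by move: IH; rewrite sE => <-; case: ifP.
Qed.

Lemma size_segments w : w != [::] -> size (segments w) = (crossings w).+1.
Proof.
elim: w => // a [|b w] IH // _; have [s [ss [-> sE]]] := segmentsE a b w.
have {}IH := IH isT; rewrite sE in IH.
rewrite (crossings_cons _ _ a) [starts _]/=.
by case: ifP => _; rewrite ?add1n ?add0n -IH.
Qed.

Definition adjacent s t := turn (last a1 s) (head a1 t).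

Lemma sorted_segments w : sorted adjacent (segments w).
Proof.
elim: w => // a [|b w] IH //; have [s [ss [-> sE]]] := segmentsE a b w.
move: IH; rewrite sE /=; case: ifP => [ab|_] /=; first by rewrite /adjacent /= ab.
by case: ss {sE}.
Qed.

Lemma segments_neq0 w s : s \in segments w -> s != [::].
Proof.
elim: w => // a [|b w] IH; first by rewrite inE => /eqP->.
have [s' [ss [-> sE]]] := segmentsE a b w; move: IH; rewrite sE.
case: ifP => _ IH; rewrite inE => /orP[/eqP->//|//] h.
by apply: IH; rewrite inE h orbT.
Qed.

Lemma walk_src x a w y : walk G x (a :: w) y -> src G a = x.
Proof. by move=> /and3P[_ /eqP]. Qed.

Lemma walk_last x a w y : walk G x (a :: w) y -> tgt G (last a w) = y.
Proof.
elim: w a x => [|b w IH] a x; first by move=> /and3P[_ _ /eqP].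
by move=> /= /and3P[_ _ h]; apply: IH h.
Qed.

Lemma turn_src b c : turn b c -> src G c = src G a1.
Proof. by move=> /orP[]/andP[_ /eqP->] //; rewrite (foldable_src fG). Qed.

Lemma turn_end b c : turn b c -> tgt G b = src G a1.
Proof. by move=> tbc; rewrite -(src_turn fG tbc); apply: turn_src tbc. Qed.

(** An inner segment is a loop at the source of the folded turn.  It has at least
   three letters, because a segment of two letters would either backtrack or
   identify the targets of the folded edges. *)
Lemma inner_segment w x y S1 s t S2 q : reduced w -> walk G x w y ->
    segments w = S1 ++ [:: q, s, t & S2] ->
  [/\ walk G (src G a1) s (src G a1), reduced s, adjacent q s, adjacent s t
    & 3 <= size s].
Proof.
move=> rw ww sE; have := sorted_segments w; rewrite sE => /cat_sorted2[_].
move=> /= /and3P[qs st _].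
have sn : s != [::].
  by apply: (@segments_neq0 w); rewrite sE mem_cat !inE eqxx !orbT.
have wE := flatten_segments w; rewrite sE flatten_cat /= in wE.
rewrite -wE catA in rw ww; have [_ rs] := reduced_cat rw.
have {rs} [rs _] := reduced_cat rs.
have [x1 _ ws] := walk_catE ww; have {ws} [x2 ws _] := walk_catE ws.
case: s {wE sE rw ww} sn rs ws qs st => // b s _ rs ws qs st.
have x1E : x1 = src G a1 by rewrite -(walk_src ws); apply: turn_src qs.
have x2E : x2 = src G a1 by rewrite -(walk_last ws); apply: turn_end st.
split=> //; first by rewrite x1E x2E in ws.
move: qs st; rewrite /adjacent /= => qs st.
have bs : b = a1 \/ b = a2.
  by move: qs => /orP[]/andP[_ /eqP]; [right|left].
case: s rs ws st => [|c [|d s]] //= rs ws st.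
  by have := turn_turn fG (head a1 t) qs; rewrite st.
have cE : c = letterV a1 \/ c = letterV a2.
  by move: st => /orP[]/andP[/eqP]; [left|right].
have t12 := foldable_tgt mG fG.
move: ws => /and5P[_ _ _ /eqP]; case: bs cE rs => -> [] -> /=;
  rewrite ?eqxx //= -[src _ (letterV _)]/(tgt _ _) => _ t21.
  by rewrite t21 eqxx in t12.
by rewrite t21 eqxx in t12.
Qed.

Definition reduced_loop s :=
  [/\ walk G (src G a1) s (src G a1), reduced s & s != [::]].

(** A reduced walk that crosses the folded turn many times has two consecutive
   inner segments that are short compared with the folded walk. *)
Lemma short_crossing w x y (m := crossings w) :
    reduced w -> walk G x w y -> 3 <= m ->
  exists u s t v, [/\ w = u ++ s ++ t ++ v, adjacent s t,
    walk G x u (src G a1),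
    reduced_loop s /\ reduced_loop t
    & size (s ++ t) * m <= 18 * (size w - m.*2)].
Proof.
move=> rw ww m3; have w0 : w != [::] by move: m3; rewrite /m; case: (w).
have := size_segments w0; rewrite -/m.
case sE: (segments w) => [//|s0 S] [sS].
case: (lastP S) sS sE => [|I sl]; first by move=> m0; rewrite -m0 in m3.
rewrite size_rcons; case: I => [|s1 I] mI sE.
  by rewrite -mI in m3.
(* There are [m - 2 >= m / 3] pairs of consecutive inner segments.  They meet each
   inner segment at most twice, and at least a third of an inner segment survives
   the fold, whence the constant [18 = 3 * 2 * 3]. *)
pose R := (18 * (size w - m.*2)) %/ m.
have m0 : 0 < m by apply: leq_trans m3.
have context p1 s p2 : s1 :: I = p1 ++ s :: p2 -> exists S1 t S2,
    segments w = S1 ++ [:: last s0 p1, s, t & S2] /\ t = head sl p2.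
  move=> IE; rewrite sE IE rcons_cat -cat_cons lastI cat_rcons.
  by case: p2 {IE} => [|t p2]; exists (belast s0 p1); eexists; eexists; split.
have len3 s : s \in s1 :: I -> 3 <= size s.
  move=> sI; have [p1 [p2 IE]] : exists p1 p2, s1 :: I = p1 ++ s :: p2.
    by case/splitPr: sI => p1 p2; exists p1, p2.
  have [S1 [t [S2 [SE _]]]] := context _ _ _ IE.
  by have [_ _ _ _] := inner_segment rw ww SE.
have [closeI|] := boolP (path (fun s t => R < size s + size t) s1 I).
  have sum_le : size I * R.+1 + size s1 <= 2 * sumn (map size (s1 :: I)).
    by rewrite -(size_map size) path_sum_lt // path_map.
  have sum_ge : 3 * size (s1 :: I) <= sumn (map size (s1 :: I)).
    elim: (s1 :: I) len3 => // s l IH ls /=; rewrite mulnS leq_add //.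
      by apply: ls; rewrite inE eqxx.
    by apply: IH => t tl; apply: ls; rewrite inE tl orbT.
  have ne s : s \in segments w -> 0 < size s.
    by move/segments_neq0; case: (s).
  have s00 : 0 < size s0 by apply: ne; rewrite sE inE eqxx.
  have sl0 : 0 < size sl by apply: ne; rewrite sE !(inE, mem_rcons) eqxx !orbT.
  have szw : size w = size s0 + (sumn (map size (s1 :: I)) + size sl).
    rewrite -[in LHS](flatten_segments w) sE size_flatten /shape /= map_rcons.
    by rewrite -cats1 sumn_cat /= addn0 !addnA.
  have R18 : 18 * (size w - m.*2) < R.+1 * m by apply: ltn_ceil.
  move: (sumn _) sum_le sum_ge szw => Sg sum_le sum_ge szw.
  have mE : m = (size I).+2 by rewrite -mI.
  have I1 : 1 <= size I by move: m3; rewrite mE.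
  exfalso; move: R18 sum_le; rewrite mE szw -muln2 mulnC.
  move: sum_ge I1 s00 sl0 => /=.
  by move: (size I) (size s0) (size sl) (size s1) R.+1; nia.
move=> npath; have [p1 [s [t [p2 [IE]]]]] := not_path_split npath.
rewrite -leqNgt => stR.
have [S1 [t' [S2 [SE /= tE]]]] := context _ _ _ IE; subst t'.
have [wS rS _ st s3] := inner_segment rw ww SE.
have IE2 : s1 :: I = rcons p1 s ++ t :: p2 by rewrite cat_rcons.
have [T1 [t' [T2 [TE _]]]] := context _ _ _ IE2.
have [wT rT _ _ t3] := inner_segment rw ww TE.
have s00 : s != [::] by case: (s) s3.
have t00 : t != [::] by case: (t) t3.
have := flatten_segments w; rewrite sE IE rcons_cat -cat_cons flatten_cat /=.
move=> wE'; exists (flatten (s0 :: p1)), s, t, (flatten (rcons p2 sl)); split=> //.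
  move: ww; rewrite -wE' => /walk_catE[z wu wst].
  case: s s00 wS wst {IE IE2 SE TE st stR wE' rS s3} => // b s _ wS wst.
  by rewrite -[X in walk _ _ _ X](walk_src wS) (walk_src wst).
rewrite size_cat; apply: leq_trans (leq_trunc_div _ m).
by rewrite leq_mul2r stR orbT.
Qed.
End Segments.

(** * The potential of a marked graph *)

Section Potential.
Variables (k r : nat) (V : finType) (lab : 'I_k -> 'I_r).
Notation H := 'rV['F_2]_r.
Notation chains := {ffun 'I_k * H -> 'F_2}.
Implicit Types (G : graph k r V) (W : 'I_r -> seq (letter k)).
Implicit Types (c : {ffun 'I_r * H -> 'F_2}) (X : chains).

Definition nz (x : 'F_2) : nat := (x != 0).

Definition supp X : nat := (\sum_q nz (X q))%N.

(** Each factor is one plus the size of the chain of the cover of the graph that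
   realizes a given chain of the cover of the rose.  This indexing allows the
   potentials of different graphs to be compared factor by factor. *)
Definition potential W : nat :=
  (\prod_(c : {ffun 'I_r * H -> 'F_2}) (supp (realize lab W c)).+1)%N.

Lemma potential_gt0 W : (0 < potential W)%N.
Proof. by rewrite /potential prodn_gt0. Qed.

Lemma supp_le X (N : {set 'I_k}) : (forall e g, X (e, g) != 0 -> e \in N) ->
  (supp X <= #|N| * #|{: H}|)%N.
Proof.
move=> XN; rewrite /supp (eq_bigr (fun q => nz (X (q.1, q.2)))).
  rewrite -(pair_bigA _ (fun e g => nz (X (e, g)))) /=.
  rewrite (bigID (mem N)) /= [X in (_ + X)%N]big1 => [|e eN]; last first.
    by apply: big1 => g _; apply/eqP; rewrite eqb0 negbK; apply: contraNT eN; apply: XN.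
  rewrite addn0 -sum_nat_const; apply: leq_sum => e _.
  by rewrite -sum1_card; apply: leq_sum => g _; rewrite /nz; case: (_ != _).
by case.
Qed.

Section FoldPotential.
Variables (G : graph k r V) (a1 a2 : letter k).
Hypotheses (mG : marked lab G) (fG : foldable lab G a1 a2).
Let e1 := a1.1.
Let e2 := a2.1.

(** The chain map induced by the fold. *)
Definition merge_chain X : chains :=
  [ffun q => if q.1 == e2 then 0
             else if q.1 == e1 then X q + X (e2, q.2) else X q].

Lemma mergeD X Y : merge_chain (X + Y) = merge_chain X + merge_chain Y.
Proof.
apply/ffunP => q; rewrite !ffunE; case: ifP => _; first by rewrite addr0.
by case: ifP => _ //; rewrite addrACA.
Qed.

Lemma merge_cell p : merge_chain (cell p) = cell (fold_edge a1 a2 p.1, p.2).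
Proof.
have ne := foldable_edge fG.
apply/ffunP => -[e g]; case: p => e' g'; rewrite !ffunE !xpair_eqE /= /fold_edge.
rewrite -/e1 -/e2 in ne *.
have [->|ne'] := eqVneq e' e2; have [->|ee2] := eqVneq e e2;
  rewrite ?(negPf ne) //=.
- by rewrite eq_sym (negPf ne).
- by rewrite add0r; case: (e == e1).
- by rewrite eq_sym (negPf ne').
- by rewrite addr0 if_same.
Qed.

Lemma chain_fold_letter h w :
  chain lab h (map (fold_letter a1 a2) w) = merge_chain (chain lab h w).
Proof.
have stepE e : step lab (fold_edge a1 a2 e) = step lab e.
  by rewrite /step /fold_edge; case: eqVneq => // ->; rewrite (foldable_lab fG).
elim: w h => [|a w IH] h /=.
  by apply/ffunP => q; rewrite !ffunE addr0 !if_same.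
by rewrite mergeD merge_cell -IH stepE /ledge /= stepE.
Qed.

Lemma realize_fold c :
  realize lab (petal (fold G a1 a2)) c = merge_chain (realize lab (petal G) c).
Proof.
apply/ffunP => q; rewrite !ffunE /=.
under eq_bigr do rewrite chain_fold_letter ffunE.
case: ifP => _; first by rewrite big1 // => p _; rewrite mulr0.
by case: ifP => _ //; rewrite -big_split; apply: eq_bigr => p _; rewrite mulrDr.
Qed.

Lemma supp_split X : supp X = (\sum_g nz (X (e2, g))
  + (\sum_g nz (X (e1, g))
     + \sum_(e | (e != e2) && (e != e1)) \sum_g nz (X (e, g))))%N.
Proof.
rewrite /supp (eq_bigr (fun q => nz (X (q.1, q.2)))); last by case.
rewrite -(pair_bigA _ (fun e g => nz (X (e, g)))) /=.
by rewrite (bigD1 e2) //= (bigD1 e1) ?(foldable_edge fG).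
Qed.

(** Chains are taken modulo two, so two odd edges cancel when they are folded
   together. *)
Lemma supp_merge X g0 (d := (X (e1, g0) != 0) && (X (e2, g0) != 0)) :
  (supp (merge_chain X) + d.*2 <= supp X)%N.
Proof.
have ne := foldable_edge fG; rewrite -/e1 -/e2 in ne.
rewrite !supp_split big1 => [|g _]; last by rewrite ffunE /= eqxx.
rewrite add0n addnA addnAC; apply: leq_add; last first.
  apply: leq_sum => e /andP[/negPf n2 /negPf n1]; apply: leq_sum => g _.
  by rewrite ffunE /= n2 n1.
pose both g := (X (e1, g) != 0) && (X (e2, g) != 0).
have bound g : (nz (merge_chain X (e1, g)) + (both g).*2
      <= nz (X (e2, g)) + nz (X (e1, g)))%N.
  rewrite /nz /both ffunE /= (negPf ne) eqxx.
  have [->|/F2_neq0->] := eqVneq (X (e1, g)) 0.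
    by rewrite add0r; case: (_ == _).
  have [->|/F2_neq0->] := eqVneq (X (e2, g)) 0; first by rewrite addr0 oner_eq0.
  by rewrite F2_addxx eqxx.
rewrite -big_split (bigD1 g0) //= [leqRHS](bigD1 g0) //= addnAC leq_add //.
by apply: leq_sum => g _; apply: leq_trans (leq_addr _ _) (bound g).
Qed.

Lemma potential_fold : (potential (petal (fold G a1 a2)) <= potential (petal G))%N.
Proof.
apply: leq_prod => c _; rewrite ltnS realize_fold.
by apply: leq_trans (leq_addr _ _) (supp_merge _ 0).
Qed.

(** A chain that is odd on two edges folded together loses both of them, and the
   smaller the chain, the larger the proportion of the potential that is lost. *)
Lemma potential_fold_drop c g (s := supp (realize lab (petal G) c))
    (P := potential (petal G)) (P' := potential (petal (fold G a1 a2))) :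
    realize lab (petal G) c (e1, g) != 0 ->
    realize lab (petal G) c (e2, g) != 0 ->
  (P' <= (P - P') * s)%N.
Proof.
move=> c1 c2; have := supp_merge (realize lab (petal G) c) g.
rewrite c1 c2 -realize_fold -/s /= => drop.
rewrite /P' /P /potential (bigD1 c) //= [X in (X - _)%N](bigD1 c) //= -/s.
have : (\prod_(c' | c' != c) (supp (realize lab (petal (fold G a1 a2)) c')).+1
    <= \prod_(c' | c' != c) (supp (realize lab (petal G) c')).+1)%N.
  apply: leq_prod => c' _; rewrite ltnS realize_fold.
  by apply: leq_trans (leq_addr _ _) (supp_merge _ 0).
move: drop; set s' := supp _; move: s s' => s s' drop.
move: (\prod_(_ | _) _)%N (\prod_(_ | _) _)%N => Q Q' QQ.
have : (s'.+1 * Q' <= s.-1 * Q')%N by rewrite leq_mul2r; apply/orP; right; lia.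
have : (s.+1 * Q' <= s.+1 * Q)%N by rewrite leq_mul2l QQ orbT.
have -> : (s.+1 * Q' = s.-1 * Q' + 2 * Q')%N.
  by rewrite -mulnDl; congr (_ * _)%N; lia.
move: (s'.+1 * Q')%N (s.+1 * Q)%N => A B BQ AB.
have QA : (2 * Q' <= B - A)%N by lia.
apply: leq_trans (leq_mul QA (leqnn s)).
by apply: leq_trans AB _; rewrite mulnC; apply: leq_mul; lia.
Qed.

End FoldPotential.

Section LoopCycles.
Variables (G : graph k r V) (mG : marked lab G) (x : V) (p : seq (letter k)).
Hypothesis px : walk G (base G) p x.

Lemma shift_surj (h : H) : exists z : seq (letter r), shift id z = h.
Proof.
exists [seq (i, true) | i <- enum 'I_r & h 0 i != 0].
rewrite /shift big_map big_filter big_enum_cond /=; apply/rowP => j.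
rewrite summxE; under eq_bigr do rewrite mxE eqxx /=.
have [hj|hj] := eqVneq (h 0 j) 0.
  rewrite hj big1 // => i hi; have [ji|//] := eqVneq j i.
  by rewrite -ji hj eqxx in hi.
rewrite (bigD1 j) //= eqxx (F2_neq0 hj) big1 ?addr0 // => i /andP[_ /negPf ij].
by rewrite eq_sym ij.
Qed.

(** Conjugating a loop that closes up in the cover only translates its lift. *)
Lemma loop_realized w h : walk G x w x -> shift lab w = 0 ->
  exists c, realize lab (petal G) c = chain lab h w.
Proof.
move=> ww w0; have [z zE] := shift_surj (h + shift lab p).
pose q := subst_word (petal G) z ++ p.
have wq : walk G (base G) q x by exact: (walk_catI (walk_subst _ mG) px).
have qE : shift lab q = h.
  by rewrite shift_cat shift_ev ev_subst // val_wval_gen shift_nf zE H_addK.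
clearbody q; have cq : chain lab h (word_inv q) = chain lab 0 q.
  by rewrite -(chain_inv lab 0 q) add0r qE.
have wqwq : walk G (base G) (q ++ w ++ word_inv q) (base G).
  by apply: (walk_catI wq); apply: (walk_catI ww); apply: walk_inv.
exists (chain id 0 (val (ev lab (q ++ w ++ word_inv q)))).
rewrite -(chain_closed mG wqwq) !chain_cat add0r qE w0 addr0 cq addrCA.
by rewrite chains_addxx addr0.
Qed.

End LoopCycles.
End Potential.

(** * Lengths along a folding sequence *)

Lemma bernoulli_nat (D a b : nat) : (b <= a)%N ->
  (b ^ D.+1 + D.+1 * (a - b) * b ^ D <= a ^ D.+1)%N.
Proof.
move=> ba; elim: D => [|D IH]; first by rewrite !expn1 expn0; lia.
rewrite [leqRHS]expnS; apply: leq_trans (leq_mul (leqnn a) IH).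
have -> : a = (b + (a - b))%N by lia.
move: (a - b)%N => c; rewrite addKn [in (b ^ D.+2)%N]expnS [(b ^ D.+1)%N]expnS.
by move: (b ^ D)%N => B; nia.
Qed.

Section Lengths.
Variables (k r : nat) (V : finType) (lab : 'I_k -> 'I_r).
Notation H := 'rV['F_2]_r.
Implicit Types (G : graph k r V) (w : seq (letter k)).

Section OneFold.
Variables (G : graph k r V) (a1 a2 : letter k).
Hypotheses (mG : marked lab G) (fG : foldable lab G a1 a2).

(** The two loops on either side of a crossing carry cycles of the cover through
   each of the folded edges; some combination of translates of these cycles
   passes through two edges that are folded together. *)
Lemma short_cycle u s t : walk G (base G) u (src G a1) ->
    reduced_loop G a1 s -> reduced_loop G a1 t -> adjacent a1 a2 s t ->
  exists c, [/\ realize lab (petal G) c (a1.1, 0) != 0,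
    realize lab (petal G) c (a2.1, 0) != 0
    & (supp (realize lab (petal G) c) <= size (s ++ t) * #|{: H}|)%N].
Proof.
move=> wu [ws rs s0] [wt rt t0] st.
have [N [sN tN NC]] : exists N : {set 'I_k},
    [/\ inside N (word_inv s), inside N t & (#|N| <= size (s ++ t))%N].
  exists [set e | e \in map fst (s ++ t)].
  have NE w : {subset map fst w <= map fst (s ++ t)} ->
      inside [set e | e \in map fst (s ++ t)] w.
    by move=> sub; apply/allP => a aw; rewrite inE sub // map_f.
  rewrite inside_inv; split.
  - by apply: NE => e es; rewrite map_cat mem_cat es.
  - by apply: NE => e et; rewrite map_cat mem_cat et orbT.
  - by rewrite cardsE; apply: leq_trans (card_size _) _; rewrite size_map.
have odd_cycle a b p q : a.1 != b.1 -> src G a = src G a1 -> src G b = src G a1 ->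
    walk G (src G a1) (a :: p) (src G a1) -> reduced (a :: p) ->
    inside N (a :: p) ->
    walk G (src G a1) (b :: q) (src G a1) -> reduced (b :: q) ->
    inside N (b :: q) ->
  exists c, realize lab (petal G) c (a.1, 0) != 0 /\
    forall e g, realize lab (petal G) c (e, g) != 0 -> e \in N.
  move=> nab sa sb wa ra aN wb rb bN.
  have [w [ww wN w0 [g wg]]] := odd_loop_turn mG wu nab sa sb wa ra aN wb rb bN.
  have [c cE] := loop_realized mG wu g ww w0.
  exists c; rewrite cE; split.
    by rewrite -(H_addxx g) -{1}(add0r g) chain_translate.
  move=> e g'; apply: contraNT => eN; rewrite chain_notin //.
  apply: contra eN => /mapP[b' b'w ->]; exact: (allP wN).
have wsi := walk_inv ws; have rsi := reduced_inv rs.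
have [c1 [c2 [c1E c1N c2E c2N]]] : exists c1 c2,
   [/\ realize lab (petal G) c1 (a1.1, 0) != 0,
       forall e g, realize lab (petal G) c1 (e, g) != 0 -> e \in N,
       realize lab (petal G) c2 (a2.1, 0) != 0 &
       forall e g, realize lab (petal G) c2 (e, g) != 0 -> e \in N].
  have ne := foldable_edge fG; have ne' : a2.1 != a1.1 by rewrite eq_sym.
  have s12 := esym (foldable_src fG).
  case: t t0 wt rt st tN {NC} => // b t _ wt rt st tN.
  case/lastP: s s0 wsi rsi sN st {ws rs} => // s a _.
  rewrite -cats1 word_inv_cat /= => wsi rsi sN; rewrite /adjacent last_cat /=.
  move=> /orP[]/andP[/eqP aE /eqP bE]; subst a b; rewrite letterVK in wsi rsi sN.
    have [c1 [h1 h2]] := odd_cycle _ _ _ _ ne erefl s12 wsi rsi sN wt rt tN.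
    have [c2 [h3 h4]] := odd_cycle _ _ _ _ ne' s12 erefl wt rt tN wsi rsi sN.
    by exists c1, c2.
  have [c1 [h1 h2]] := odd_cycle _ _ _ _ ne erefl s12 wt rt tN wsi rsi sN.
  have [c2 [h3 h4]] := odd_cycle _ _ _ _ ne' s12 erefl wsi rsi sN wt rt tN.
  by exists c1, c2.
have small c : (forall e g, realize lab (petal G) c (e, g) != 0 -> e \in N) ->
    (supp (realize lab (petal G) c) <= size (s ++ t) * #|{: H}|)%N.
  by move=> /supp_le/leq_trans; apply; rewrite leq_mul2r NC orbT.
have [h12|h12] := eqVneq (realize lab (petal G) c1 (a2.1, 0)) 0; last first.
  by exists c1; split=> //; apply: small.
have [h21|h21] := eqVneq (realize lab (petal G) c2 (a1.1, 0)) 0; last first.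
  by exists c2; split=> //; apply: small.
exists (c1 + c2); split.
- by rewrite realizeD chainsD h21 addr0.
- by rewrite realizeD chainsD h12 add0r.
apply: small => e g; rewrite realizeD chainsD.
have [z1|z1] := eqVneq (realize lab (petal G) c1 (e, g)) 0; last by rewrite (c1N e g).
by rewrite z1 add0r; apply: c2N.
Qed.

Let P := potential lab (petal G).
Let P' := potential lab (petal (fold G a1 a2)).
(* The factor [36] is twice the constant of [short_crossing], as each crossing
   costs two letters. *)
Let D := (36 * #|{: H}|)%N.

(** The length lost in a fold is at most four, or else, as a proportion of the
   folded length, at most [D] times the proportion by which the potential drops;
   the inequality of Bernoulli turns the latter into a [D]-th power. *)
Lemma fold_length w y : reduced w -> walk G (base G) w y ->
  (size w * P' ^ D <= size (nfold a1 a2 w) * P ^ D + 4 * P' ^ D)%N.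
Proof.
move=> rw ww; have [_ wE] := nfold_spec mG fG rw ww.
have PP : (P' <= P)%N by apply: potential_fold.
have h0 : (0 < #|{: H}|)%N by apply/card_gt0P; exists 0.
have D0 : (0 < D)%N by rewrite muln_gt0.
have [m2|m3] := leqP (crossings a1 a2 w) 2.
  apply: leq_trans (_ : (size (nfold a1 a2 w) + 4) * P' ^ D <= _)%N.
    by rewrite leq_mul2r; apply/orP; right; lia.
  by rewrite mulnDl leq_add2r leq_mul2l leq_exp2r ?PP ?orbT.
have [u [s [t [v [wst st wu [ls lt] stm]]]]] := short_crossing mG fG rw ww m3.
have [c [c1 c2 cs]] := short_cycle wu ls lt st.
have drop := potential_fold_drop fG c1 c2.
rewrite -/P -/P' in drop.
have X2 : (size w - (crossings a1 a2 w).*2 = size (nfold a1 a2 w))%N by lia.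
rewrite X2 in stm.
move: drop cs stm wE; move: (supp _) (size (s ++ t)) (crossings _ _ w) => S R m.
move: (size w) (size (nfold _ _ w)) => L X drop cs stm wE.
have key : (2 * m * P' <= X * (D * (P - P')))%N.
  apply: leq_trans (_ : 2 * m * ((P - P') * (R * #|{: H}|)) <= _)%N.
    rewrite leq_mul2l; apply/orP; right; apply: leq_trans drop _.
    by rewrite leq_mul2l cs orbT.
  rewrite /D; move: (P - P')%N #|{: H}| => d h.
  have -> : (2 * m * (d * (R * h)) = R * m * (2 * (d * h)))%N by lia.
  have -> : (X * (36 * h * d) = 18 * X * (2 * (d * h)))%N by lia.
  by rewrite leq_mul2r stm orbT.
apply: leq_trans (leq_addr _ _).
have [D1 DE] : exists D1, D = D1.+1 by exists D.-1; rewrite prednK.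
have := bernoulli_nat D1 PP; rewrite -DE => bern.
apply: leq_trans (leq_mul (leqnn X) bern).
rewrite -wE mulnDl mulnDr leq_add2l -muln2 DE expnS -DE.
move: (P' ^ D1)%N (P - P')%N key => B d key.
have -> : (m * 2 * (P' * B) = B * (2 * m * P'))%N by lia.
have -> : (X * (D * d * B) = B * (X * (D * d)))%N by lia.
by rewrite leq_mul2l key orbT.
Qed.

End OneFold.

(** When nothing can be folded, reduced walks have reduced labels. *)
Lemma immersed_size G w x y : marked lab G ->
    (forall a1 a2, ~ foldable lab G a1 a2) -> reduced w -> walk G x w y ->
  size w = wlen (ev lab w).
Proof.
move=> mG nf rw ww; rewrite ev_label /wlen val_wval_gen nf_id ?size_map //.
elim: w x rw ww => // a [|b w] IH x // /andP[ba rw] /= /and3P[aA _ wb].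
apply/andP; split; last exact: IH rw wb.
apply/eqP => -[lb sb]; apply: (nf (letterV a) b).
have /and3P[bA /eqP sbE _] := wb.
by split=> //; rewrite ?lb // eq_sym.
Qed.

Lemma short_petal_immersed G i : marked lab G ->
    (~ exists a1 a2, foldable lab G a1 a2) -> exists w,
  [/\ walk G (base G) w (base G), ev lab w = gen i
    & (size w <= potential lab (petal G) ^ (36 * #|{: H}|)
                  * (1 + 4 * #|active G|))%N].
Proof.
move=> mG imm; exists (nf (petal G i)).
have ww : walk G (base G) (nf (petal G i)) (base G) by exact: walk_nf (marked_walk mG i).
have wi : ev lab (nf (petal G i)) = gen i by rewrite ev_nf (marked_ev mG).
split=> //; rewrite (immersed_size mG _ (reduced_nf _) ww) ?wi.
  by rewrite muln_gt0 expn_gt0 potential_gt0.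
by move=> a1 a2 fG; apply: imm; exists a1, a2.
Qed.

(** By induction on the number of edges: a reduced loop that spells a generator
   folds to the reduced form of the short loop found in the folded graph. *)
Lemma short_petals G i : marked lab G -> exists w,
  [/\ walk G (base G) w (base G), ev lab w = gen i
    & (size w <= potential lab (petal G) ^ (36 * #|{: H}|)
                  * (1 + 4 * #|active G|))%N].
Proof.
elim: {G}#|active G| {-2}G (erefl #|active G|) => [|n IH] G Gn mG;
  have [[a1 [a2 fG]]|nf] := pselect (exists a1 a2, foldable lab G a1 a2).
- by have := foldable_active1 fG; rewrite (cards0_eq Gn) inE.
- exact: short_petal_immersed.
- have A' : #|active (fold G a1 a2)| = n.
    have := cardsD1 a2.1 (active G); rewrite Gn (foldable_active2 fG) add1n.
    by case=> ->.
  have [w' [ww' w'i w's]] := IH _ A' (fold_marked mG fG).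
  pose w := nf (petal G i).
  have ww : walk G (base G) w (base G) by exact: walk_nf (marked_walk mG i).
  have wi : ev lab w = gen i by rewrite ev_nf (marked_ev mG).
  exists w; split=> //.
  have le' : (size (nfold a1 a2 w) <= size w')%N.
    have fm := fold_marked mG fG.
    have wf := walk_fold_letter fG ww.
    rewrite /nfold (nf_subst fm wf) (ev_fold_letter fG) wi -w'i -(nf_subst fm ww').
    exact: size_nf.
  have := fold_length mG fG (reduced_nf _) ww; rewrite -/w.
  have := potential_gt0 lab (petal (fold G a1 a2)).
  rewrite A' in w's; rewrite Gn; move: (36 * _)%N w's => D w's Q0 step.
  have QD : (0 < potential lab (petal (fold G a1 a2)) ^ D)%N by rewrite expn_gt0 Q0.
  have P0 : (0 < potential lab (petal G) ^ D)%N by rewrite expn_gt0 potential_gt0.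
  rewrite -(leq_pmul2r QD); apply: leq_trans step _.
  have := leq_mul (leq_trans le' w's) (leqnn (potential lab (petal G) ^ D)).
  move: (potential lab (petal G) ^ D)%N P0 => p P0.
  move: (potential lab (petal (fold G a1 a2)) ^ D)%N QD => q QD.
  by move: (size _ * p)%N => X; nia.
- exact: short_petal_immersed.
Qed.

End Lengths.

(** * The rose subdivided along the images of a basis *)

Section SubdividedRose.
Local Open Scope nat_scope.
Local Open Scope group_scope.
Variables (r : nat) (f : aut (free_group r)).

Let n := aut_norm f.
Let b i := val (f (gen i)).

Notation rose_edge := ('I_r * 'I_n.+1)%type.
Notation k := #|{: rose_edge}|.

Lemma size_image i : size (b i) <= n.
Proof. by rewrite /n /aut_norm (bigD1 i) //= leq_addr. Qed.

Definition image_letter i j : letter r := nth (i, true) (b i) j.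
Definition code i j : 'I_k := enum_rank (i, inord j : 'I_n.+1).

Definition decode (e : 'I_k) : rose_edge := enum_val e.

Definition rose_lab (e : 'I_k) : 'I_r :=
  (image_letter (decode e).1 (decode e).2).1.

Definition vertex i j : option rose_edge :=
  if 0 < j < size (b i) then Some (i, inord j) else None.

Definition rose_arc i :=
  [seq (code i j, (image_letter i j).2) | j <- iota 0 (size (b i))].

Definition rose_src (e : 'I_k) := let: (i, j) := decode e in
  if (image_letter i j).2 then vertex i j else vertex i j.+1.
Definition rose_tgt (e : 'I_k) := let: (i, j) := decode e in
  if (image_letter i j).2 then vertex i j.+1 else vertex i j.

(** The petals of a marked graph spell the standard basis, whereas the arcs of
   the subdivided rose spell its image, whence the substitution. *)
Definition rose : graph k r (option rose_edge) :=
  Graph [set e | (decode e).2 < size (b (decode e).1)] rose_src rose_tgt None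
    (fun i => subst_word rose_arc (val (f^-1 (gen i)))).

Lemma code_val i j : j < size (b i) -> decode (code i j) = (i, inord j).
Proof. by rewrite /decode /code enum_rankK. Qed.

Lemma inordK_image i j : j < size (b i) -> nat_of_ord (inord j : 'I_n.+1) = j.
Proof. by move=> jb; rewrite inordK // ltnS (leq_trans (ltnW jb)) ?size_image. Qed.

Lemma size_arc i : size (rose_arc i) = size (b i).
Proof. by rewrite size_map size_iota. Qed.

Lemma nth_arc a i j : j < size (b i) ->
  nth a (rose_arc i) j = (code i j, (image_letter i j).2).
Proof. by move=> jb; rewrite (nth_map 0) ?size_iota // nth_iota. Qed.

Lemma src_arc i j : j < size (b i) ->
  src rose (code i j, (image_letter i j).2) = vertex i j.
Proof.
move=> jb; rewrite /src /= /rose_src /rose_tgt code_val // (inordK_image jb).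
by case: ((image_letter i j).2).
Qed.

Lemma tgt_arc i j : j < size (b i) ->
  tgt rose (code i j, (image_letter i j).2) = vertex i j.+1.
Proof.
move=> jb; rewrite /tgt /src /= /rose_src /rose_tgt code_val // (inordK_image jb).
by case: ((image_letter i j).2).
Qed.

Lemma walk_arc i : walk rose None (rose_arc i) None.
Proof.
have arcs m j : (j + m = size (b i))%N -> walk rose (vertex i j)
    [seq (code i j', (image_letter i j').2) | j' <- iota j m] None.
  elim: m j => [|m IH] j jm.
    by rewrite /vertex -jm addn0 ltnn andbF.
  have jb : j < size (b i) by rewrite -jm addnS ltnS leq_addr.
  rewrite [iota _ _]/= [map _ _]/= [walk _ _ _ _]/=.
  rewrite src_arc // tgt_arc // eqxx IH ?addSnnS // andbT.
  by rewrite inE code_val //= (inordK_image jb) jb.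
by have := arcs (size (b i)) 0%N (add0n _); rewrite /vertex ltnn.
Qed.

Lemma ev_arc i : ev rose_lab (rose_arc i) = f (gen i).
Proof.
rewrite -[RHS]wval_gen -/(b i) ev_label; congr wval.
apply: (@eq_from_nth _ (i, true)); rewrite !size_map size_iota // => j jb.
rewrite (nth_map (code i 0, true)) ?size_arc // nth_arc //= /rose_lab.
by rewrite code_val //= (inordK_image jb) -surjective_pairing.
Qed.

(** The inverse of the subdivision, up to homotopy: an edge counts as a whole
   petal if it is the last one of its arc, and not at all otherwise. *)
Definition collapse (e : 'I_k) : seq (letter r) := let: (i, j) := decode e in
  if j.+1 == size (b i) then [:: (i, (image_letter i j).2)] else [::].

Section Prefix.
Variables (Gam : groupType) (g : 'I_k -> Gam).

(** The value of the arc that leads from the base point to a vertex. *)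
Definition prefix_val (v : option rose_edge) : Gam :=
  if v is Some (i, j) then wval g (take j (rose_arc i)) else 1.

Lemma prefix_vertex i j : j < size (b i) ->
  prefix_val (vertex i j) = wval g (take j (rose_arc i)).
Proof.
rewrite /vertex => jb; rewrite jb andbT; case: j jb => [|j] jb /=.
  by rewrite take0.
by rewrite (inordK_image jb).
Qed.

Lemma prefix_edge e : e \in active rose ->
  prefix_val (rose_src e) * g e =
    wval (fun i => wval g (rose_arc i)) (collapse e) * prefix_val (rose_tgt e).
Proof.
rewrite inE /rose_src /rose_tgt /collapse.
have : e = code (decode e).1 (decode e).2.
  by rewrite /code inord_val -surjective_pairing /decode enum_valK.
case: (decode e) => i j /= -> jb.
have stepE : wval g (take j.+1 (rose_arc i)) =
    wval g (take j (rose_arc i)) * lval g (code i j, (image_letter i j).2).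
  rewrite (take_nth (code i j, true)) ?size_arc // nth_arc //.
  by rewrite -cats1 wval_cat /= mulg1.
have := prefix_vertex jb; move: stepE.
have [lastj|notlast] := eqVneq j.+1 (size (b i)).
  have -> : take j.+1 (rose_arc i) = rose_arc i by rewrite lastj -size_arc take_size.
  have pS : prefix_val (vertex i j.+1) = 1 by rewrite /vertex lastj ltnn andbF.
  move=> aE pE; move: aE; rewrite /lval; case: ((image_letter i j).2) => /= aE.
    by rewrite pE pS /= /lval /= aE !mulg1.
  by rewrite pE pS /= /lval /= aE invgM invgK mulg1 mulgVK mul1g.
have jb' : j.+1 < size (b i) by rewrite ltn_neqAle notlast.
rewrite -(prefix_vertex jb') => sE pE; rewrite mul1g; move: sE; rewrite /lval.
by case: ((image_letter i j).2) => /= ->; rewrite pE // mulgVK.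
Qed.

(** Read in the free group on the edges, this shows that a loop is determined by
   its collapse; read in the free group on the labels, that its label is the
   image of its collapse under [f]. *)
Lemma prefix_walk x w y : walk rose x w y ->
  prefix_val x * wval g w =
    wval (fun i => wval g (rose_arc i)) (subst_word collapse w) * prefix_val y.
Proof.
elim: w x => [|[e c] w IH] x /=; first by move=> /eqP->; rewrite mulg1 mul1g.
move=> /and3P[eA /eqP<- /IH wE]; rewrite /subst_word /= wval_cat -/(subst_word _ w).
rewrite -mulgA -wE !mulgA; congr (_ * _); have eE := prefix_edge eA.
rewrite /tgt /src /lval; case: c {wE} => //=.
by apply: (mulIg (g e)); rewrite wval_inv mulgVK -mulgA eE mulKg.
Qed.

End Prefix.

Lemma ev_subst_arc z : ev rose_lab (subst_word rose_arc z) = f (wval (@gen r) z).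
Proof.
rewrite /ev wval_subst (wval_comp _ _ (autM f)).
by apply: eq_wval => i; apply: ev_arc.
Qed.

Lemma ev_collapse x w : walk rose x w x -> exists y,
  y * ev rose_lab w = f (wval (@gen r) (subst_word collapse w)) * y.
Proof.
move=> /(prefix_walk (fun e => gen (rose_lab e))) wE.
exists (prefix_val (fun e => gen (rose_lab e)) x).
rewrite wE; congr (_ * _); rewrite (wval_comp _ _ (autM f)).
by apply: eq_wval => i; apply: ev_arc.
Qed.

Lemma rose_marked : marked rose_lab rose.
Proof.
split=> [x w ww w1|i|i].
- have [y] := ev_collapse ww; rewrite w1 mulg1 -{1}(mul1g y) => /mulIg/esym.
  rewrite -(aut1 f) => /(bij_inj (aut_bij f)) c1.
  have c0 := wval_gen_eq (v := [::]) c1.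
  have := prefix_walk (@gen _) ww; rewrite (wval_eq _ c0) mul1g.
  rewrite -[RHS]mulg1 => /mulgI w1'; exact: (wval_gen_eq (v := [::])).
- by apply: walk_substI => j; apply: walk_arc.
- by rewrite ev_subst_arc wval_gen /= aut_fK.
Qed.

Lemma size_collapse w : size (subst_word collapse w) <= size w.
Proof.
elim: w => //= a w IH; rewrite /subst_word /= size_cat -[(size w).+1]add1n leq_add //.
have s1 : size (collapse a.1) <= 1.
  by rewrite /collapse; case: decode => i j; case: ifP.
by case: (a.2); rewrite ?size_word_inv.
Qed.

End SubdividedRose.

Lemma supp_card k r (X : {ffun 'I_k * 'rV['F_2]_r -> 'F_2}) :
  (supp X <= k * #|{: 'rV['F_2]_r}|)%N.
Proof.
by apply: leq_trans (supp_le (N := setT) _) _; rewrite ?cardsT ?card_ord // => e g; rewrite inE.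
Qed.

(** The inverse of an automorphism is read off the short petals of the
   subdivided rose, whose potential is polynomial in the norm. *)
Lemma inverse_polynomial (r : nat) : exists C M : nat,
  forall f : aut (free_group r), (aut_norm f^-1%g <= C * aut_norm f ^ M)%N.
Proof.
pose h := #|{: 'rV['F_2]_r}|; pose D := (36 * h)%N.
pose B := #|{: {ffun 'I_r * 'rV['F_2]_r -> 'F_2}}|.
have bound (f : aut (free_group r)) (k := #|{: 'I_r * 'I_(aut_norm f).+1}|) :
    (aut_norm f^-1%g <= r * (((k * h).+1 ^ B) ^ D * (1 + 4 * k)))%N.
  rewrite {1}/aut_norm -[X in (X * _)%N]card_ord -sum_nat_const; apply: leq_sum => i _.
  have [w [ww wi ws]] := short_petals i (rose_marked f).
  have wE : (f^-1%g : aut _) (gen i) = wval (@gen r) (subst_word (@collapse r f) w).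
    have := prefix_walk (fun e => gen (rose_lab e)) ww; rewrite /= mul1g mulg1.
    rewrite -/(ev _ w) wi => giE; apply: (bij_inj (aut_bij f)).
    rewrite /= aut_fK giE (wval_comp _ _ (autM f)).
    by apply: eq_wval => j; apply: ev_arc.
  rewrite wE /wlen val_wval_gen; apply: leq_trans (size_nf _) _.
  apply: leq_trans (size_collapse _) _; apply: leq_trans ws _.
  apply: leq_mul; last by rewrite leq_add2l leq_mul2l -[X in (_ <= X)%N]card_ord max_card.
  rewrite leq_exp2r; last by rewrite muln_gt0; apply/card_gt0P; exists 0.
  rewrite /potential -prod_nat_const; apply: leq_prod => c _.
  by rewrite ltnS supp_card.
exists (r * (2 * r * h).+1 ^ (B * D) * (1 + 8 * r))%N, (B * D).+1 => f.
have [r0|r0] := posnP r.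
  by apply: leq_trans (bound f) _; rewrite [X in (X * _ <= _)%N]r0.
have n0 : (0 < aut_norm f)%N := leq_trans r0 (aut_norm_ge f).
apply: leq_trans (bound f) _; rewrite card_prod !card_ord -!mulnA leq_mul2l.
apply/orP; right; move: (aut_norm f) n0 => n n0.
rewrite -expnM.
have rn : (r * n.+1 <= 2 * r * n)%N by nia.
apply: leq_trans (_ : ((2 * (r * h)).+1 * n) ^ (B * D) * ((1 + 8 * r) * n) <= _)%N.
  apply: leq_mul; last by nia.
  have [->|BD] := posnP (B * D)%N; first by rewrite !expn0.
  by rewrite leq_exp2r //; nia.
by rewrite expnMn expnSr; move: (_ ^ _)%N (n ^ _)%N => x y; apply: eq_leq; lia.
Qed.

(** * Automorphisms that are short but have long inverses *)

Lemma aut_VK (G : groupType) (f : aut G) x : f ((f^-1%g : aut G) x) = x.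
Proof. exact: aut_fK. Qed.

Section FreeHom.
Local Open Scope nat_scope.
Local Open Scope group_scope.
Variable r : nat.
Notation F := (free_group r).
Implicit Types (a : letter r) (u v w : seq (letter r)).

Definition free_hom (im : 'I_r -> F) (x : F) : F := wval im (val x).

Lemma free_homM im : {morph free_hom im : x y / x * y}.
Proof. by move=> x y; apply: wval_mul. Qed.

Lemma free_hom_gen im i : free_hom im (gen i) = im i.
Proof. by rewrite /free_hom /= mulg1. Qed.

Lemma free_hom_wval im w : free_hom im (wval (@gen r) w) = wval im w.
Proof. by rewrite /free_hom val_wval_gen wval_nf. Qed.

Lemma free_homK im im' :
  (forall i, free_hom im (im' i) = gen i) -> cancel (free_hom im') (free_hom im).
Proof.
move=> imK x; rewrite [free_hom im' x](_ : _ = wval im' (val x)) //.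
rewrite (wval_comp _ _ (free_homM im)) -[RHS]wval_gen.
exact: eq_wval.
Qed.

Section FreeAut.
Variables (im im' : 'I_r -> F).
Hypotheses (imK : forall i, free_hom im (im' i) = gen i)
  (im'K : forall i, free_hom im' (im i) = gen i).

Definition free_aut : aut F := Aut (free_homM im)
  (Bijective (free_homK im'K) (free_homK imK)).

Lemma free_aut_gen i : free_aut (gen i) = im i.
Proof. exact: free_hom_gen. Qed.

Lemma free_autV x : (free_aut^-1 : aut F) x = free_hom im' x.
Proof.
by apply: (bij_inj (aut_bij free_aut)); rewrite aut_VK /= (free_homK imK).
Qed.

End FreeAut.

Definition expsum (w : seq (letter r)) : int := (\sum_(a <- w) (-1) ^+ (~~ a.2))%R.

Lemma expsum_push a w : (expsum (push a w) = (-1) ^+ (~~ a.2) + expsum w)%R.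
Proof.
rewrite /expsum; case: w => [|b w]; first by rewrite big_seq1 big_nil addr0.
rewrite /=; case: ifP => [/eqP ->|_]; last by rewrite big_cons.
by rewrite big_cons /= addrA; case: a.2; rewrite ?expr0 ?expr1 ?subrr ?addNr add0r.
Qed.

Lemma expsum_mul u v : (expsum (word_mul u v) = expsum u + expsum v)%R.
Proof.
elim: u => [|a u IH] /=; first by rewrite /expsum big_nil add0r.
by rewrite expsum_push IH /expsum big_cons addrA.
Qed.

Lemma expsum_nf w : expsum (nf w) = expsum w.
Proof. by rewrite expsum_mul /expsum big_nil addr0. Qed.

Lemma expsumV (x : F) : expsum (val x^-1) = (- expsum (val x))%R.
Proof.
apply/eqP; rewrite -addr_eq0 -expsum_mul.
by rewrite -[word_mul _ _]/(val (x^-1 * x)) mulVg /expsum big_nil.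
Qed.

Lemma expsum_le w : (`|expsum w| <= size w)%R.
Proof.
rewrite /expsum; apply: le_trans (ler_norm_sum _ _ _) _.
rewrite (eq_bigr (fun=> 1%R)) => [|a _]; last by rewrite normrX normrN1 expr1n.
by rewrite big_const_seq count_predT iter_addr addr0 natz.
Qed.

Lemma expsum_positive w : all snd w -> expsum w = (size w : int).
Proof.
elim: w => [|a w IH] /=; first by rewrite /expsum big_nil.
move=> /andP[a2 /IH wE]; rewrite /expsum big_cons -/(expsum w) wE a2 expr0.
by rewrite intS.
Qed.

(** The exponent sum is invariant under conjugation and bounds the length. *)
Lemma positive_conj_size w (x : F) :
  all snd w -> size w <= wlen (x^-1 * wval (@gen r) w * x).
Proof.
move=> w2; have := expsum_le (val (x^-1 * wval (@gen r) w * x)).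
rewrite !expsum_mul expsumV addrAC addNr add0r val_wval_gen expsum_nf.
by rewrite expsum_positive // normr_nat lez_nat.
Qed.

Lemma positive_reduced w : all snd w -> reduced w.
Proof.
elim: w => // a [|b w] IH // /and3P[a2 b2 w2]; rewrite /reduced /=.
rewrite [path _ _ _]IH /= ?b2 // andbT; apply/eqP => /(congr1 snd) /=.
by rewrite a2 b2.
Qed.

Lemma wlenX (x : F) n : wlen (x ^+ n) <= n * wlen x.
Proof.
elim: n => // n IH; rewrite expgS mulSn; apply: leq_trans (wlenM _ _) _.
by rewrite leq_add2l.
Qed.

Lemma wval_nseq (w : seq (letter r)) n :
  wval (@gen r) (flatten (nseq n w)) = wval (@gen r) w ^+ n.
Proof. by elim: n => // n IH; rewrite /= wval_cat IH expgS. Qed.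

Lemma size_nseq_flatten w n :
  size (flatten (nseq n w)) = (n * size w)%N.
Proof. by elim: n => // n IH; rewrite /= size_cat IH mulSn. Qed.

Lemma all_nseq_flatten w n :
  all snd w -> all snd (flatten (nseq n w)).
Proof. by move=> w2; elim: n => // n IH; rewrite /= all_cat w2. Qed.

End FreeHom.

Section Tower.
Local Open Scope nat_scope.
Local Open Scope group_scope.
Variables (q k : nat).
Notation r := q.+1.
Notation F := (free_group r).

Definition tower_letter j : letter r := (inord j, true).

Fixpoint tower j : seq (letter r) :=
  if j is j'.+1 then flatten (nseq k (tower j')) ++ [:: tower_letter j]
  else [:: tower_letter 0].

Lemma tower_positive j : all snd (tower j).
Proof. by elim: j => // j IH; rewrite /= all_cat all_nseq_flatten. Qed.

Lemma size_tower j : k ^ j <= size (tower j).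
Proof.
elim: j => //= j IH; rewrite size_cat size_nseq_flatten expnS.
by apply: leq_trans (leq_addr _ _); rewrite leq_mul2l IH orbT.
Qed.

Lemma tower_last j : exists w, tower j = rcons w (tower_letter j).
Proof.
case: j => [|j]; first by exists [::].
by exists (flatten (nseq k (tower j))); rewrite -cats1.
Qed.

Definition up (i : 'I_r) : F := wval (@gen r) (tower i).

(** The automorphism whose inverse sends the basis to the tower. *)
Definition down (i : 'I_r) : F :=
  if nat_of_ord i is j.+1 then gen (inord j : 'I_r) ^- k * gen i else gen i.

Lemma up_down i : free_hom up (down i) = gen i.
Proof.
have hX x n : free_hom up (x ^+ n) = free_hom up x ^+ n.
  elim: n => // n IH; by rewrite !expgS free_homM IH.
have hV x : free_hom up x^-1 = (free_hom up x)^-1 by apply: wval_inv.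
rewrite /down; case iE: (nat_of_ord i) => [|j].
  rewrite free_hom_gen /up iE /= mulg1 /lval /tower_letter /=.
  by congr gen; apply: val_inj; rewrite /= inordK // iE.
have jq : j < q.+1 by rewrite ltnW // -iE ltn_ord.
rewrite free_homM hV hX !free_hom_gen /up iE inordK //= wval_cat wval_nseq.
rewrite mulKg /= mulg1 /lval /tower_letter /=.
by congr gen; apply: val_inj; rewrite /= inordK -?iE.
Qed.

Lemma down_up i : free_hom down (up i) = gen i.
Proof.
rewrite /up free_hom_wval; case: i => j jq; rewrite [nat_of_ord _]/=.
have towerE m : m < q.+1 -> wval down (tower m) = gen (inord m).
  elim: m => [|m IH] mq; first by rewrite /= mulg1 /lval /down /= inordK.
  have -> : wval down (tower m.+1) = wval down (tower m) ^+ k * down (inord m.+1).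
    rewrite /= wval_cat /= mulg1; congr (_ * _).
    by elim: (k) => // n IHn; rewrite /= wval_cat IHn expgS.
  by rewrite IH 1?ltnW // /down inordK // mulVKg.
by rewrite towerE //; congr gen; apply: val_inj; rewrite /= inordK.
Qed.

Definition tower_aut : aut F := free_aut down_up up_down.

Lemma tower_aut_gen i : tower_aut (gen i) = down i.
Proof. exact: free_aut_gen. Qed.

Lemma tower_autV i : (tower_aut^-1 : aut F) (gen i) = up i.
Proof. by rewrite free_autV free_hom_gen. Qed.

Lemma wlen_down i : wlen (down i) <= k + 1.
Proof.
rewrite /down; case: (nat_of_ord i) => [|j]; first by rewrite leq_addl.
apply: leq_trans (wlenM _ _) _; rewrite wlenV leq_add2r.
by apply: leq_trans (wlenX _ _) _; rewrite muln1.
Qed.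

Lemma aut_norm_le (f : aut F) m : (forall i, wlen (f (gen i)) <= m) ->
  aut_norm f <= r * m.
Proof.
by move=> fm; rewrite -[r in leqRHS]card_ord -sum_nat_const; apply: leq_sum.
Qed.

Lemma wlen_le_norm (f : aut F) i : wlen (f (gen i)) <= aut_norm f.
Proof. by rewrite /aut_norm (bigD1 i) //= leq_addr. Qed.

(** The inverse of the tower automorphism is positive, so the exponent sum, which
   conjugation preserves, gives the length of its longest value. *)
Lemma beta_lower n : r * (k + 1) <= n -> maxn 1 k ^ q <= beta r n.
Proof.
move=> kn; pose P := out_class tower_aut.
have inP : out_set P tower_aut by apply/inn_cosetP; exists 1; rewrite inner1 mulg1.
have Pn : out_norm P <= n.
  have [_ /(_ _ inP) h] := out_normP P; apply: leq_trans h _; apply: leq_trans kn.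
  by apply: aut_norm_le => i; rewrite tower_aut_gen wlen_down.
have [_] := beta_max Pn; apply: leq_trans.
have [[f Pf <-] _] := out_normP (P^-1).
have [k0|k0] := posnP k.
  by rewrite k0 exp1n; apply: leq_trans (aut_norm_ge f).
rewrite (maxn_idPr k0); have [g ->] : exists g, f = tower_aut^-1 * inner g.
  by move: Pf; rewrite -[P^-1]/(out_inv P) out_class_inv => /inn_cosetP.
apply: leq_trans (wlen_le_norm _ (inord q)) => /=.
have := tower_autV (inord q); rewrite /= => ->; rewrite /up inordK //.
by apply: leq_trans (size_tower q) _; apply: positive_conj_size; apply: tower_positive.
Qed.

(** Conjugation by a power of the last generator is cheap before inversion and
   expensive after it: the inverse sends the first generator to its conjugate by
   the [k]-th power of the last word of the tower.  This conjugate is reduced as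
   written, because the tower word is positive and does not end with the first
   generator. *)
Lemma alpha_lower n : 0 < q -> r * (3 * k + 1) <= n -> maxn 1 k ^ r <= alpha r n.
Proof.
move=> q0 kn; pose g : F := gen (inord q : 'I_r) ^+ k.
pose f := tower_aut * inner g.
have glen : wlen g <= k by apply: leq_trans (wlenX _ _) _; rewrite muln1.
have fn : aut_norm f <= n.
  apply: leq_trans kn; apply: aut_norm_le => i; rewrite /f /=.
  have := tower_aut_gen i; rewrite /= => ->.
  apply: leq_trans (wlenM _ _) _.
  apply: leq_trans (leq_add (wlenM _ _) (leqnn _)) _; rewrite wlenV.
  by have := wlen_down i; lia.
have [_] := alpha_max fn; apply: leq_trans.
have [k0|k0] := posnP k.
  by rewrite k0 exp1n; apply: leq_trans (aut_norm_ge _).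
rewrite (maxn_idPr k0).
pose X := flatten (nseq k (tower q)).
have fV : (f^-1 : aut F) (gen (inord 0)) =
    wval (@gen r) (X ++ tower_letter 0 :: word_inv X).
  apply: (bij_inj (aut_bij f)); rewrite aut_VK.
  have fw w : f (wval (@gen r) w) = g^-1 * tower_aut (wval (@gen r) w) * g by [].
  have tX : tower_aut (wval (@gen r) X) = g.
    rewrite -[wval _ X]/(wval (@gen r) (flatten _)) wval_nseq.
    have tu := aut_VK tower_aut (gen (inord q)); rewrite tower_autV in tu.
    rewrite /up inordK // in tu.
    have tM := autM tower_aut; rewrite /g -tu.
    by elim: (k) => [|n' IH]; rewrite ?aut1 // !expgS tM IH.
  rewrite fw -[tower_letter 0 :: _]cat1s !wval_cat wval_inv.
  rewrite (autM tower_aut) (autM tower_aut) autV tX !mulgA mulVg mul1g mulgVK.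
  by rewrite mulg1 /lval /= /down inordK.
apply: leq_trans (wlen_le_norm _ (inord 0)); rewrite fV /wlen val_wval_gen nf_id.
  rewrite size_cat /= size_nseq_flatten; apply: leq_trans (leq_addr _ _).
  by rewrite expnS leq_mul2l size_tower orbT.
have [Y XE] : exists Y, X = rcons Y (tower_letter q).
  have [w wE] := tower_last q; exists (flatten (nseq k.-1 (tower q)) ++ w).
  rewrite /X rcons_cat -wE -[in LHS](prednK k0) [nseq _.+1 _]/= [LHS]/=.
  elim: (k.-1) => [|m IH] /=; first by rewrite cats0.
  by rewrite -catA -IH.
have X2 : all snd X by apply: all_nseq_flatten; apply: tower_positive.
have redX c : reduced (rcons X c) = (c != letterV (tower_letter q)).
  have := positive_reduced X2; rewrite XE /reduced.
  case: Y {XE} => [|y Y] /=; first by rewrite andbT.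
  by move=> pY; rewrite rcons_path pY last_rcons.
have r1 : reduced (rcons X (tower_letter 0)).
  by rewrite redX; apply/eqP => /(congr1 snd).
have r2 : reduced (tower_letter 0 :: word_inv X).
  have -> : tower_letter 0 :: word_inv X = word_inv (rcons X (letterV (tower_letter 0))).
    by rewrite -cats1 word_inv_cat /= letterVK.
  apply: reduced_inv; rewrite redX (inj_eq (@letterV_inj _)).
  apply/eqP => /(congr1 (fun a : letter r => nat_of_ord a.1)) /=.
  by rewrite !inordK // => q1; rewrite -q1 in q0.
move: r1 r2; rewrite /reduced -cats1; case: X {XE X2 redX fV} => // x X.
by rewrite /= !cat_path /= => /andP[-> /andP[-> _]] ->.
Qed.

End Tower.

(** * Bounds on the two functions *)

(** The class of an automorphism of minimal norm has inverse of norm at most that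
   of the inverse automorphism, so the bound for automorphisms suffices. *)
Lemma beta_upper (r : nat) : exists C M : nat, forall n,
  (beta r n <= C * n ^ M)%N.
Proof.
have [C [M CM]] := inverse_polynomial r; exists C, M => n.
have [nr|rn] := ltnP n r; first by rewrite beta_eq0.
have one_norm : (aut_norm (1%g : aut (free_group r)) <= n)%N.
  by apply: leq_trans rn; rewrite /aut_norm (eq_bigr (fun=> 1%N)) // sum1_card card_ord.
have [_ /(_ 1%g) oneP] := out_normP (out_class (1%g : aut (free_group r))).
have one1 : (out_norm (out_class (1%g : aut (free_group r))) <= n)%N.
  apply: leq_trans one_norm; apply: oneP.
  by apply/inn_cosetP; exists 1%g; rewrite inner1 mulg1.
have [[P Pn <-] _] := beta_max one1.
have [[f Pf fE] _] := out_normP P; have [_ /(_ f^-1%g) le] := out_normP P^-1%g.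
apply: leq_trans (le _) _; first by exists f.
by apply: leq_trans (CM f) _; rewrite leq_mul2l fE; case: (M) => [|M'];
  rewrite ?expn0 ?leqnn ?leq_exp2r ?Pn ?orbT.
Qed.

(** The tower automorphisms have norm linear in [k], so [k] may be taken
   proportional to [n]; the maximum covers the values of [n] for which this
   proportion is zero. *)
Lemma tower_parameter (r n : nat) : (0 < r <= n)%N -> exists k,
  (r * (3 * k + 1) <= n)%N /\ (n <= 7 * r * maxn 1 k)%N.
Proof.
move=> /andP[r0 rn]; pose k := ((n - r) %/ (3 * r))%N.
have le : (k * (3 * r) <= n - r)%N by apply: leq_trunc_div.
have lt : (n - r < k.+1 * (3 * r))%N by apply: ltn_ceil; rewrite muln_gt0.
exists k; split; first by nia.
case: k {le} lt => [|k] lt; first by rewrite (_ : maxn 1 0 = 1%N) //; lia.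
by rewrite (_ : maxn 1 k.+1 = k.+1) //; nia.
Qed.

Theorem theorem1p8 (R : realType) (r : nat) (hr : (3 <= r)%N) :
  exists K K' K'' M : R,
    [/\ 0 < K, 0 < K', 0 < K'' & 0 < M] /\
    forall n : nat,
      (~~ (0 < n < r)%N -> K * n%:R ^+ r <= (alpha r n)%:R) /\
      (~~ (0 < n < r)%N -> K' * n%:R ^+ (r - 1) <= (beta r n)%:R) /\
      (beta r n)%:R <= K'' * n%:R `^ M.
Proof.
have [C [M CM]] := beta_upper r.
have lower (c m : nat) (F : nat -> nat) : (0 < c)%N -> (0 < m)%N ->
    (forall n, (r <= n)%N -> exists2 k, (n <= c * k)%N & (k ^ m <= F n)%N) ->
  forall n, ~~ (0 < n < r)%N -> (c%:R ^- m) * n%:R ^+ m <= (F n)%:R :> R.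
  move=> c0 m0 Fm n; rewrite negb_and -leqNgt leqn0 -leqNgt.
  have [-> _|n0 /= rn] := eqVneq n 0%N; first by rewrite expr0n -leqn0 leqNgt m0 mulr0.
  have [k nk kF] := Fm n rn.
  rewrite mulrC ler_pdivrMr ?exprn_gt0 ?ltr0n // -!natrX -natrM ler_nat.
  apply: leq_trans (_ : (c * k) ^ m <= _)%N; first by rewrite leq_exp2r.
  by rewrite expnMn mulnC leq_mul2r kF orbT.
have c0 : (0 < 7 * r)%N by rewrite muln_gt0 (leq_trans _ hr).
have K0 m : 0 < ((7 * r)%:R ^- m : R) by rewrite invr_gt0 exprn_gt0 // ltr0n.
exists ((7 * r)%:R ^- r), ((7 * r)%:R ^- (r - 1)), C.+1%:R, M.+1%:R.
split; first by rewrite !K0 !ltr0n.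
case: r hr CM lower c0 K0 => // q hr CM lower c0 K0 n.
have q0 : (0 < q)%N by lia.
split; [|split].
- apply: (lower (7 * q.+1)%N q.+1 (alpha q.+1)) => // {}n rn.
  have [k [k1 k2]] := tower_parameter (n := n) (r := q.+1) rn.
  by exists (maxn 1 k) => //; apply: alpha_lower.
- rewrite subn1 /=; apply: (lower (7 * q.+1)%N q (beta q.+1)) => // {}n rn.
  have [k [k1 k2]] := tower_parameter (n := n) (r := q.+1) rn.
  exists (maxn 1 k) => //; apply: beta_lower; apply: leq_trans k1; nia.
rewrite powR_mulrn ?ler0n // -natrX -natrM ler_nat.
have [nr|rn] := ltnP n q.+1; first by rewrite beta_eq0.
apply: leq_trans (CM n) _; apply: leq_mul => //.
by rewrite leq_pexp2l // (leq_trans _ rn).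
Qed.
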